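(* The $K[X_d,Y_d]^{\delta}$-module $(F_{2d}')^{\delta}$ is generated by the following elements: $$[x_i,y_i],\quad 1\leq i\leq d,$$ $$[x_i,x_j],\quad 1\leq i<j\leq d,$$ $$[x_i,y_j]+[x_j,y_i],\quad 1\leq i<j\leq d,$$ $$[x_i,x_p,y_q]-[x_i,y_p,x_q],\quad 1\leq i\leq d,\ 1\leq p<q\leq d,$$ $$[x_i,x_j,y_k]-[x_i,x_k,y_j]+[x_j,x_k,y_i],\quad 1\leq i<j<k\leq d,$$ and $$[x_i,x_p,y_j,y_q]+[y_i,y_p,x_j,x_q]-[x_i,y_p,y_j,x_q]-[y_i,x_p,x_j,y_q],\quad 1\leq i<j\leq d,\ 1\leq p<q\leq d.$$
   Context: Let $K$ be a field of characteristic $0$ and $d\ge 2$. Let $F_{2d}=L_{2d}/L_{2d}''$ be the free metabelian Lie algebra over $K$ freely generated by $x_1,\ldots,x_d,y_1,\ldots,y_d$, where $L_{2d}$ is the free Lie algebra on these generators and $L_{2d}''$ is the second term of its derived series. Let $F_{2d}'=[F_{2d},F_{2d}]$ be the commutator ideal. Lie commutators are left normed: $[z_1,z_2,z_3]=[[z_1,z_2],z_3]$, $[z_1,z_2,z_3,z_4]=[[[z_1,z_2],z_3],z_4]$, and $z_1\,\mathrm{ad}z_2=[z_1,z_2]$ (operators act on the right). Let $K[X_d,Y_d]=K[x_1,\ldots,x_d,y_1,\ldots,y_d]$ be the (commutative) polynomial algebra in $2d$ variables. By the metabelian identity, $F_{2d}'$ is a right $K[X_d,Y_d]$-module with action $$u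 f(x_1,\ldots,x_d,y_1,\ldots,y_d)=u f(\mathrm{ad}x_1,\ldots,\mathrm{ad}x_d,\mathrm{ad}y_1,\ldots,\mathrm{ad}y_d),\quad u\in F_{2d}',\ f\in K[X_d,Y_d].$$ Let $\delta$ denote both the derivation of the algebra $K[X_d,Y_d]$ and the derivation of the Lie algebra $F_{2d}$ determined by $\delta(y_i)=x_i$, $\delta(x_i)=0$, $i=1,\ldots,d$. Put $K[X_d,Y_d]^{\delta}=\{f\in K[X_d,Y_d]\mid\delta(f)=0\}$ (also denoted $K[X_d,U]$; it is known to be generated as an algebra by $x_1,\ldots,x_d$ and $u_{pq}=x_py_q-y_px_q$, $1\le p<q\le d$) and $(F_{2d}')^{\delta}=\{u\in F_{2d}'\mid\delta(u)=0\}$. Then $(F_{2d}')^{\delta}$ is a $K[X_d,Y_d]^{\delta}$-submodule of $F_{2d}'$. *)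

(* Defs.v *)
From HB Require Import structures.
From mathcomp Require Import all_boot all_algebra.
From mathcomp Require Import ssrAC boolp.
From mathcomp Require Import mpoly.

Set Implicit Arguments.
Unset Strict Implicit.
Unset Printing Implicit Defensive.

Import GRing.Theory.
Local Open Scope ring_scope.
Local Open Scope quotient_scope.

HB.mixin Record Lmodule_isLie (K : fieldType) L of GRing.Lmodule K L := {
  lie : L -> L -> L;
  lieDl : forall x y z : L, lie (x + y) z = lie x z + lie y z;
  lieDr : forall x y z : L, lie x (y + z) = lie x y + lie x z;
  lieZl : forall (a : K) (x y : L), lie (a *: x) y = a *: lie x y;
  lieZr : forall (a : K) (x y : L), lie x (a *: y) = a *: lie x y;
  liexx : forall x : L, lie x x = 0;
  lie_jacobi : forall x y z : L,
    lie (lie x y) z + lie (lie y z) x + lie (lie z x) y = 0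
}.

#[short(type="lieAlgType")]
HB.structure Definition LieAlgebra (K : fieldType) :=
  {L of Lmodule_isLie K L & GRing.Lmodule K L}.

Declare Scope lie_scope.
Delimit Scope lie_scope with lie.
(* Left normed: [~ a, b, c] is [~ [~ a, b], c]. *)
Notation "[ ~ x1 , x2 , .. , xn ]" :=
  (lie .. (lie x1 x2) .. xn) : lie_scope.
Local Open Scope lie_scope.

Section LieTheory.
Variables (K : fieldType) (L : lieAlgType K).
Implicit Types x y z : L.

Lemma lie0l x : [~ 0, x] = 0 :> L.
Proof. by rewrite -[X in lie X _](scale0r (0 : L)) lieZl scale0r. Qed.

Lemma lie0r x : [~ x, 0] = 0 :> L.
Proof. by rewrite -[X in lie _ X](scale0r (0 : L)) lieZr scale0r. Qed.

Lemma lieNl x y : [~ - x, y] = - [~ x, y].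
Proof. by rewrite -scaleN1r lieZl scaleN1r. Qed.

Lemma lieNr x y : [~ x, - y] = - [~ x, y].
Proof. by rewrite -scaleN1r lieZr scaleN1r. Qed.

Lemma lie_anti x y : [~ y, x] = - [~ x, y].
Proof.
apply/eqP; rewrite -addr_eq0.
have := liexx (x + y); rewrite lieDl !lieDr !liexx add0r addr0 addrC => ->.
by rewrite eqxx.
Qed.

Lemma lie_leibniz x y z : [~ x, y, z] = [~ [~ x, z], y] + [~ x, [~ y, z]].
Proof.
have /eqP := lie_jacobi x y z; rewrite -addrA addr_eq0 => /eqP ->.
by rewrite opprD addrC -lieNl -lie_anti -lie_anti.
Qed.

Inductive lie_span (P : L -> Prop) : L -> Prop :=
| lie_span_br a b of P a & P b : lie_span P [~ a, b]
| lie_span_0 : lie_span P 0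
| lie_span_D u v of lie_span P u & lie_span P v : lie_span P (u + v)
| lie_span_Z (c : K) u of lie_span P u : lie_span P (c *: u).

Fixpoint derived_series (n : nat) : L -> Prop :=
  if n is m.+1 then lie_span (derived_series m) else fun=> True.

Record lie_ideal := LieIdeal {
  ideal_set :> L -> Prop;
  ideal_0 : ideal_set 0;
  ideal_D : forall u v, ideal_set u -> ideal_set v -> ideal_set (u + v);
  ideal_Z : forall (c : K) u, ideal_set u -> ideal_set (c *: u);
  ideal_br : forall u v, ideal_set u -> ideal_set [~ u, v]
}.

Lemma derived_series_br n u v :
  derived_series n u -> derived_series n [~ u, v].
Proof.
elim: n u => [//|n IHn] u /=; elim=> [a b Pa Pb||a b _ Pa _ Pb|c a _ Pa].
- by rewrite lie_leibniz; apply: lie_span_D; apply: lie_span_br => //;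
    apply: IHn.
- by rewrite lie0l; apply: lie_span_0.
- by rewrite lieDl; apply: lie_span_D.
- by rewrite lieZl; apply: lie_span_Z.
Qed.

Lemma derived_series_0 n : derived_series n 0.
Proof. by case: n => //= n; apply: lie_span_0. Qed.

Lemma derived_series_D n u v :
  derived_series n u -> derived_series n v -> derived_series n (u + v).
Proof. by case: n => //= n; apply: lie_span_D. Qed.

Lemma derived_series_Z n (c : K) u :
  derived_series n u -> derived_series n (c *: u).
Proof. by case: n => //= n; apply: lie_span_Z. Qed.

Definition derived_ideal n : lie_ideal :=
  LieIdeal (derived_series_0 n) (@derived_series_D n) (@derived_series_Z n)
           (@derived_series_br n).

End LieTheory.

Arguments derived_series {K} L n.
Arguments derived_ideal {K} L n.

Section LieQuotient.
Variables (K : fieldType) (L : lieAlgType K) (I : lie_ideal L).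

Definition lieq_rel (x y : L) : bool := `[< I (x - y) >].

Lemma lieq_rel_equiv : equiv_class_of lieq_rel.
Proof.
split=> [x|x y|y x z].
- by apply/asboolP; rewrite subrr; apply: ideal_0.
- apply/asboolP/asboolP => /(@ideal_Z _ _ _ (-1));
    by rewrite scaleN1r opprB.
- move=> /asboolP xy /asboolP yz; apply/asboolP.
  by have := ideal_D xy yz; rewrite addrA subrK.
Qed.

Canonical lieq_equiv := EquivRelPack lieq_rel_equiv.
Canonical lieq_enc := defaultEncModRel lieq_rel.

Definition lieq := {eq_quot lieq_rel}.
HB.instance Definition _ := Choice.on lieq.

Definition lieq_pi (x : L) : lieq := \pi_lieq x.

Lemma lieq_piP x y : lieq_pi x = lieq_pi y <-> I (x - y).
Proof. by split=> [/eqmodP/asboolP|?]; last exact/eqmodP/asboolP. Qed.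

Lemma lieq_ind (P : lieq -> Prop) : (forall x, P (lieq_pi x)) -> forall u, P u.
Proof. by move=> H; elim/quotP => x _; apply: H. Qed.

Lemma lieq_repr x : I (repr (lieq_pi x) - x).
Proof. by apply/lieq_piP; rewrite /lieq_pi reprK. Qed.

Let ideal_brr u v : I v -> I [~ u, v].
Proof.
by move=> Iv; rewrite lie_anti -scaleN1r; apply/ideal_Z/ideal_br.
Qed.

Definition lieq_add (u v : lieq) := lieq_pi (repr u + repr v).
Definition lieq_opp (u : lieq) := lieq_pi (- repr u).
Definition lieq_scale (c : K) (u : lieq) := lieq_pi (c *: repr u).
Definition lieq_lie (u v : lieq) := lieq_pi [~ repr u, repr v].

Lemma lieq_addE x y : lieq_add (lieq_pi x) (lieq_pi y) = lieq_pi (x + y).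
Proof.
by apply/lieq_piP; rewrite opprD addrACA; apply: ideal_D; apply: lieq_repr.
Qed.

Lemma lieq_scaleE c x : lieq_scale c (lieq_pi x) = lieq_pi (c *: x).
Proof. by apply/lieq_piP; rewrite -scalerBr; apply/ideal_Z/lieq_repr. Qed.

Lemma lieq_oppE x : lieq_opp (lieq_pi x) = lieq_pi (- x).
Proof.
apply/lieq_piP; rewrite -opprD -scaleN1r.
exact/ideal_Z/lieq_repr.
Qed.

Lemma lieq_lieE x y : lieq_lie (lieq_pi x) (lieq_pi y) = lieq_pi [~ x, y].
Proof.
apply/lieq_piP; set x' := repr _; set y' := repr _.
have -> : [~ x', y'] - [~ x, y] = [~ x' - x, y'] + [~ x, y' - y].
  by rewrite lieDl lieDr lieNl lieNr addrA subrK.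
by apply: ideal_D; [apply: ideal_br | apply: ideal_brr]; apply: lieq_repr.
Qed.

Fact lieq_addA : associative lieq_add.
Proof.
by do 3![elim/lieq_ind => ?]; rewrite !lieq_addE addrA.
Qed.
Fact lieq_addC : commutative lieq_add.
Proof. by do 2![elim/lieq_ind => ?]; rewrite !lieq_addE addrC. Qed.
Fact lieq_add0 : left_id (lieq_pi 0) lieq_add.
Proof. by elim/lieq_ind => ?; rewrite lieq_addE add0r. Qed.
Fact lieq_addN : left_inverse (lieq_pi 0) lieq_opp lieq_add.
Proof. by elim/lieq_ind => ?; rewrite lieq_oppE lieq_addE addNr. Qed.

HB.instance Definition _ :=
  GRing.isZmodule.Build lieq lieq_addA lieq_addC lieq_add0 lieq_addN.

Lemma lieq_piD x y : lieq_pi (x + y) = lieq_pi x + lieq_pi y.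
Proof. by rewrite -lieq_addE. Qed.

Fact lieq_scaleA a b u : lieq_scale a (lieq_scale b u) = lieq_scale (a * b) u.
Proof. by elim/lieq_ind: u => ?; rewrite !lieq_scaleE scalerA. Qed.
Fact lieq_scale1 : left_id 1 lieq_scale.
Proof. by elim/lieq_ind => ?; rewrite lieq_scaleE scale1r. Qed.
Fact lieq_scaleDr : right_distributive lieq_scale +%R.
Proof.
move=> a; do 2![elim/lieq_ind => ?].
by rewrite -lieq_piD !lieq_scaleE -lieq_piD scalerDr.
Qed.
Fact lieq_scaleDl u : {morph lieq_scale^~ u : a b / a + b}.
Proof.
elim/lieq_ind: u => x a b.
by rewrite !lieq_scaleE -lieq_piD scalerDl.
Qed.

HB.instance Definition _ :=
  GRing.Zmodule_isLmodule.Build K lieq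
    lieq_scaleA lieq_scale1 lieq_scaleDr lieq_scaleDl.

Lemma lieq_piZ c x : lieq_pi (c *: x) = c *: lieq_pi x.
Proof. by rewrite -lieq_scaleE. Qed.

Fact lieq_lieDl u v w : lieq_lie (u + v) w = lieq_lie u w + lieq_lie v w.
Proof.
elim/lieq_ind: u => x; elim/lieq_ind: v => y; elim/lieq_ind: w => z.
by rewrite -lieq_piD !lieq_lieE -lieq_piD lieDl.
Qed.
Fact lieq_lieDr u v w : lieq_lie u (v + w) = lieq_lie u v + lieq_lie u w.
Proof.
elim/lieq_ind: u => x; elim/lieq_ind: v => y; elim/lieq_ind: w => z.
by rewrite -lieq_piD !lieq_lieE -lieq_piD lieDr.
Qed.
Fact lieq_lieZl a u v : lieq_lie (a *: u) v = a *: lieq_lie u v.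
Proof.
elim/lieq_ind: u => x; elim/lieq_ind: v => y.
by rewrite -lieq_piZ !lieq_lieE -lieq_piZ lieZl.
Qed.
Fact lieq_lieZr a u v : lieq_lie u (a *: v) = a *: lieq_lie u v.
Proof.
elim/lieq_ind: u => x; elim/lieq_ind: v => y.
by rewrite -lieq_piZ !lieq_lieE -lieq_piZ lieZr.
Qed.
Fact lieq_liexx u : lieq_lie u u = 0.
Proof. by elim/lieq_ind: u => x; rewrite lieq_lieE liexx. Qed.
Fact lieq_jacobi u v w :
  lieq_lie (lieq_lie u v) w + lieq_lie (lieq_lie v w) u
    + lieq_lie (lieq_lie w u) v = 0.
Proof.
elim/lieq_ind: u => x; elim/lieq_ind: v => y; elim/lieq_ind: w => z.
by rewrite !lieq_lieE -!lieq_piD lie_jacobi.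
Qed.

HB.instance Definition _ :=
  Lmodule_isLie.Build K lieq lieq_lieDl lieq_lieDr lieq_lieZl lieq_lieZr
    lieq_liexx lieq_jacobi.

Lemma lieq_pi_lie x y : lieq_pi [~ x, y] = [~ lieq_pi x, lieq_pi y].
Proof. by rewrite -lieq_lieE. Qed.

End LieQuotient.

(* The free Lie algebra on X is the quotient of the Lie terms over X by the
   least congruence containing the Lie algebra axioms (lie_eq below); see
   free_lie_universal for its universal property. *)

Inductive lie_term (K : fieldType) (X : Type) : Type :=
| LVar of X
| LZero
| LAdd of lie_term K X & lie_term K X
| LScale of K & lie_term K X
| LBr of lie_term K X & lie_term K X.

Arguments LVar {K X} _.
Arguments LZero {K X}.

HB.instance Definition _ K X := gen_eqMixin (lie_term K X).
HB.instance Definition _ K X := gen_choiceMixin (lie_term K X).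

Section FreeLie.
Variables (K : fieldType) (X : Type).
Implicit Types s t r : lie_term K X.

(* There is no constructor for the opposite: -t is (-1)t. *)
Inductive lie_eq : lie_term K X -> lie_term K X -> Prop :=
| LE_refl t : lie_eq t t
| LE_sym s t of lie_eq s t : lie_eq t s
| LE_trans s t r of lie_eq s t & lie_eq t r : lie_eq s r
| LE_add s s' t t' of lie_eq s s' & lie_eq t t' :
    lie_eq (LAdd s t) (LAdd s' t')
| LE_scale c s s' of lie_eq s s' : lie_eq (LScale c s) (LScale c s')
| LE_br s s' t t' of lie_eq s s' & lie_eq t t' : lie_eq (LBr s t) (LBr s' t')
| LE_addA s t r : lie_eq (LAdd s (LAdd t r)) (LAdd (LAdd s t) r)
| LE_addC s t : lie_eq (LAdd s t) (LAdd t s)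
| LE_add0 t : lie_eq (LAdd LZero t) t
| LE_addN t : lie_eq (LAdd (LScale (-1) t) t) LZero
| LE_scaleA a b t : lie_eq (LScale a (LScale b t)) (LScale (a * b) t)
| LE_scale1 t : lie_eq (LScale 1 t) t
| LE_scaleDr a s t :
    lie_eq (LScale a (LAdd s t)) (LAdd (LScale a s) (LScale a t))
| LE_scaleDl a b t :
    lie_eq (LScale (a + b) t) (LAdd (LScale a t) (LScale b t))
| LE_brDl s t r : lie_eq (LBr (LAdd s t) r) (LAdd (LBr s r) (LBr t r))
| LE_brDr s t r : lie_eq (LBr s (LAdd t r)) (LAdd (LBr s t) (LBr s r))
| LE_brZl a s t : lie_eq (LBr (LScale a s) t) (LScale a (LBr s t))
| LE_brZr a s t : lie_eq (LBr s (LScale a t)) (LScale a (LBr s t))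
| LE_brxx t : lie_eq (LBr t t) LZero
| LE_jacobi s t r :
    lie_eq (LAdd (LAdd (LBr (LBr s t) r) (LBr (LBr t r) s)) (LBr (LBr r s) t))
           LZero.

Definition lie_eqb s t : bool := `[< lie_eq s t >].

Lemma lie_eqb_equiv : equiv_class_of lie_eqb.
Proof.
split=> [x|x y|y x z].
- by apply/asboolP; apply: LE_refl.
- by apply/asboolP/asboolP; apply: LE_sym.
- by move=> /asboolP xy /asboolP yz; apply/asboolP; apply: LE_trans xy yz.
Qed.

Canonical lie_eqb_equivr := EquivRelPack lie_eqb_equiv.
Canonical lie_eqb_enc := defaultEncModRel lie_eqb.

Definition free_lie := {eq_quot lie_eqb}.
HB.instance Definition _ := Choice.on free_lie.

Definition fl_pi t : free_lie := \pi_free_lie t.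

Lemma fl_piP s t : fl_pi s = fl_pi t <-> lie_eq s t.
Proof. by split=> [/eqmodP/asboolP|?]; last exact/eqmodP/asboolP. Qed.

Lemma fl_ind (P : free_lie -> Prop) : (forall t, P (fl_pi t)) -> forall u, P u.
Proof. by move=> H; elim/quotP => x _; apply: H. Qed.

Lemma fl_repr t : lie_eq (repr (fl_pi t)) t.
Proof. by apply/fl_piP; rewrite /fl_pi reprK. Qed.

Definition fl_add (u v : free_lie) := fl_pi (LAdd (repr u) (repr v)).
Definition fl_scale (c : K) (u : free_lie) := fl_pi (LScale c (repr u)).
Definition fl_opp (u : free_lie) := fl_scale (-1) u.
Definition fl_lie (u v : free_lie) := fl_pi (LBr (repr u) (repr v)).

Lemma fl_addE s t : fl_add (fl_pi s) (fl_pi t) = fl_pi (LAdd s t).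
Proof. by apply/fl_piP; apply: LE_add; apply: fl_repr. Qed.
Lemma fl_scaleE c t : fl_scale c (fl_pi t) = fl_pi (LScale c t).
Proof. by apply/fl_piP; apply: LE_scale; apply: fl_repr. Qed.
Lemma fl_lieE s t : fl_lie (fl_pi s) (fl_pi t) = fl_pi (LBr s t).
Proof. by apply/fl_piP; apply: LE_br; apply: fl_repr. Qed.

Fact fl_addA : associative fl_add.
Proof.
do 3![elim/fl_ind => ?]; rewrite !fl_addE.
by apply/fl_piP; apply: LE_addA.
Qed.
Fact fl_addC : commutative fl_add.
Proof.
by do 2![elim/fl_ind => ?]; rewrite !fl_addE; apply/fl_piP; apply: LE_addC.
Qed.
Fact fl_add0 : left_id (fl_pi LZero) fl_add.
Proof. by elim/fl_ind => ?; rewrite fl_addE; apply/fl_piP; apply: LE_add0. Qed.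
Fact fl_addN : left_inverse (fl_pi LZero) fl_opp fl_add.
Proof.
elim/fl_ind => ?; rewrite /fl_opp fl_scaleE fl_addE.
by apply/fl_piP; apply: LE_addN.
Qed.

HB.instance Definition _ :=
  GRing.isZmodule.Build free_lie fl_addA fl_addC fl_add0 fl_addN.

Lemma fl_piD s t : fl_pi (LAdd s t) = fl_pi s + fl_pi t.
Proof. by rewrite -fl_addE. Qed.

Fact fl_scaleA a b u : fl_scale a (fl_scale b u) = fl_scale (a * b) u.
Proof.
by elim/fl_ind: u => ?; rewrite !fl_scaleE; apply/fl_piP; apply: LE_scaleA.
Qed.
Fact fl_scale1 : left_id 1 fl_scale.
Proof.
by elim/fl_ind => ?; rewrite fl_scaleE; apply/fl_piP; apply: LE_scale1.
Qed.
Fact fl_scaleDr : right_distributive fl_scale +%R.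
Proof.
move=> a; do 2![elim/fl_ind => ?].
rewrite -fl_piD !fl_scaleE -fl_piD.
by apply/fl_piP; apply: LE_scaleDr.
Qed.
Fact fl_scaleDl u : {morph fl_scale^~ u : a b / a + b}.
Proof.
elim/fl_ind: u => x a b; rewrite !fl_scaleE -fl_piD.
by apply/fl_piP; apply: LE_scaleDl.
Qed.

HB.instance Definition _ :=
  GRing.Zmodule_isLmodule.Build K free_lie
    fl_scaleA fl_scale1 fl_scaleDr fl_scaleDl.

Lemma fl_piZ c t : fl_pi (LScale c t) = c *: fl_pi t.
Proof. by rewrite -fl_scaleE. Qed.

Fact fl_lieDl u v w : fl_lie (u + v) w = fl_lie u w + fl_lie v w.
Proof.
elim/fl_ind: u => x; elim/fl_ind: v => y; elim/fl_ind: w => z.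
by rewrite -fl_piD !fl_lieE -fl_piD; apply/fl_piP; apply: LE_brDl.
Qed.
Fact fl_lieDr u v w : fl_lie u (v + w) = fl_lie u v + fl_lie u w.
Proof.
elim/fl_ind: u => x; elim/fl_ind: v => y; elim/fl_ind: w => z.
by rewrite -fl_piD !fl_lieE -fl_piD; apply/fl_piP; apply: LE_brDr.
Qed.
Fact fl_lieZl a u v : fl_lie (a *: u) v = a *: fl_lie u v.
Proof.
elim/fl_ind: u => x; elim/fl_ind: v => y.
by rewrite -fl_piZ !fl_lieE -fl_piZ; apply/fl_piP; apply: LE_brZl.
Qed.
Fact fl_lieZr a u v : fl_lie u (a *: v) = a *: fl_lie u v.
Proof.
elim/fl_ind: u => x; elim/fl_ind: v => y.
by rewrite -fl_piZ !fl_lieE -fl_piZ; apply/fl_piP; apply: LE_brZr.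
Qed.
Fact fl_liexx u : fl_lie u u = 0.
Proof.
by elim/fl_ind: u => x; rewrite fl_lieE; apply/fl_piP; apply: LE_brxx.
Qed.
Fact fl_jacobi u v w :
  fl_lie (fl_lie u v) w + fl_lie (fl_lie v w) u + fl_lie (fl_lie w u) v = 0.
Proof.
elim/fl_ind: u => x; elim/fl_ind: v => y; elim/fl_ind: w => z.
by rewrite !fl_lieE -!fl_piD; apply/fl_piP; apply: LE_jacobi.
Qed.

HB.instance Definition _ :=
  Lmodule_isLie.Build K free_lie fl_lieDl fl_lieDr fl_lieZl fl_lieZr
    fl_liexx fl_jacobi.

Lemma fl_pi_lie s t : fl_pi (LBr s t) = [~ fl_pi s, fl_pi t].
Proof. by rewrite -fl_lieE. Qed.

Definition fl_gen (z : X) : free_lie := fl_pi (LVar z).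

End FreeLie.

Arguments fl_gen K {X} z.

Section FreeLieUniversal.
Variables (K : fieldType) (X : Type) (L : lieAlgType K) (f : X -> L).

Fixpoint lie_eval (t : lie_term K X) : L :=
  match t with
  | LVar z => f z
  | LZero => 0
  | LAdd s t => lie_eval s + lie_eval t
  | LScale c t => c *: lie_eval t
  | LBr s t => [~ lie_eval s, lie_eval t]
  end.

Lemma lie_eval_eq s t : lie_eq s t -> lie_eval s = lie_eval t.
Proof.
elim=> //=; try by move=> *; congruence.
- by move=> *; rewrite addrA.
- by move=> *; rewrite addrC.
- by move=> *; rewrite add0r.
- by move=> *; rewrite scaleN1r addNr.
- by move=> *; rewrite scalerA.
- by move=> *; rewrite scale1r.
- by move=> *; rewrite scalerDr.
- by move=> *; rewrite scalerDl.
- by move=> *; rewrite lieDl.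
- by move=> *; rewrite lieDr.
- by move=> *; rewrite lieZl.
- by move=> *; rewrite lieZr.
- by move=> *; rewrite liexx.
- by move=> *; rewrite lie_jacobi.
Qed.

Theorem free_lie_universal :
  exists! h : free_lie K X -> L,
    [/\ forall (c : K) u v, h (c *: u + v) = c *: h u + h v,
        forall u v, h [~ u, v] = [~ h u, h v]
      & forall z, h (fl_gen K z) = f z].
Proof.
pose h (u : free_lie K X) := lie_eval (repr u).
have hE t : h (fl_pi t) = lie_eval t by exact/lie_eval_eq/fl_repr.
exists h; split.
  split=> [c u v|u v|z]; last by rewrite hE.
    elim/fl_ind: u => s; elim/fl_ind: v => t.
    by rewrite -fl_piZ -fl_piD !hE.
  elim/fl_ind: u => s; elim/fl_ind: v => t.
  by rewrite -fl_pi_lie !hE.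
move=> g [gL gB gV]; apply/funext; elim/fl_ind => t; rewrite hE; apply: esym.
have g0 : g 0 = 0.
  have := gL (-1) 0 0; rewrite !scaler0 addr0 scaleN1r addNr; exact.
have gD u v : g (u + v) = g u + g v.
  by have := gL 1 u v; rewrite !scale1r.
have gZ c u : g (c *: u) = c *: g u.
  by have := gL c u 0; rewrite !addr0 g0 addr0.
elim: t => [z||s IHs t IHt|c t IHt|s IHs t IHt] /=.
- by rewrite -gV.
- exact: g0.
- by rewrite fl_piD gD IHs IHt.
- by rewrite fl_piZ gZ IHt.
- by rewrite fl_pi_lie gB IHs IHt.
Qed.

End FreeLieUniversal.

Definition lie_derivation (K : fieldType) (L : lieAlgType K)
    (D : {linear L -> L}) : Prop :=
  forall u v : L, D [~ u, v] = [~ D u, v] + [~ u, D v].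

Definition poly_derivation (K : fieldType) (n : nat)
    (D : {linear {mpoly K[n]} -> {mpoly K[n]}}) : Prop :=
  forall f g, D (f * g) = D f * g + f * D g.

Section FreeLieDerivation.
Variables (K : fieldType) (X : Type) (f : X -> free_lie K X).

Fixpoint der_eval (t : lie_term K X) : free_lie K X :=
  match t with
  | LVar z => f z
  | LZero => 0
  | LAdd s t => der_eval s + der_eval t
  | LScale c t => c *: der_eval t
  | LBr s t => [~ der_eval s, fl_pi t] + [~ fl_pi s, der_eval t]
  end.

Lemma der_eval_eq s t : lie_eq s t -> der_eval s = der_eval t.
Proof.
elim=> //=; try by move=> *; congruence.
- move=> s0 s' t0 t' /fl_piP -> -> /fl_piP -> ->; reflexivity.
- by move=> *; rewrite addrA.
- by move=> *; rewrite addrC.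
- by move=> *; rewrite add0r.
- by move=> *; rewrite scaleN1r addNr.
- by move=> *; rewrite scalerA.
- by move=> *; rewrite scale1r.
- by move=> *; rewrite scalerDr.
- by move=> *; rewrite scalerDl.
- by move=> *; rewrite fl_piD !lieDl addrACA.
- by move=> *; rewrite fl_piD !lieDr addrACA.
- by move=> *; rewrite fl_piZ !lieZl scalerDr.
- by move=> *; rewrite fl_piZ !lieZr scalerDr.
- by move=> t0; rewrite lie_anti addNr.
- move=> a b c; rewrite !fl_pi_lie !lieDl.
  set a' := der_eval a; set b' := der_eval b; set c' := der_eval c.
  set u := fl_pi a; set v := fl_pi b; set w := fl_pi c.
  have := lie_jacobi a' v w; have := lie_jacobi u b' w.
  have := lie_jacobi u v c'.
  move: [~ a', v, w] [~ v, w, a'] [~ w, a', v] => a1 a2 a3.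
  move: [~ u, b', w] [~ b', w, u] [~ w, u, b'] => b1 b2 b3.
  move: [~ u, v, c'] [~ v, c', u] [~ c', u, v] => c1 c2 c3 hc hb ha.
  rewrite -[RHS](addr0 0) -{1}ha -[X in _ = _ + X]addr0 -{1}hb -hc.
  rewrite [LHS](AC (3*3*3) ((1*6*8)*((2*4*9)*(3*5*7)))) /=.
  by rewrite addrA.
Qed.

Lemma free_lie_derivation :
  exists2 D : {linear free_lie K X -> free_lie K X},
    lie_derivation D & forall z, D (fl_gen K z) = f z.
Proof.
pose h (u : free_lie K X) := der_eval (repr u).
have hE t : h (fl_pi t) = der_eval t by exact/der_eval_eq/fl_repr.
have hL : linear h.
  move=> c u v; elim/fl_ind: u => s; elim/fl_ind: v => t.
  by rewrite -fl_piZ -fl_piD !hE.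
pose hLM := GRing.isLinear.Build K (free_lie K X) (free_lie K X) _ h hL.
pose D : {linear free_lie K X -> free_lie K X} := HB.pack h hLM.
exists D => [u v|z]; last exact: hE.
elim/fl_ind: u => s; elim/fl_ind: v => t.
by rewrite /D /= -fl_pi_lie !hE.
Qed.

End FreeLieDerivation.

Section QuotientDerivation.
Variables (K : fieldType) (L : lieAlgType K).
Variables (D : {linear L -> L}) (derD : lie_derivation D).

Lemma derived_series_derivation n u :
  derived_series L n u -> derived_series L n (D u).
Proof.
elim: n u => [//|n IHn] u /=; elim=> [a b Pa Pb||a b _ Pa _ Pb|c a _ Pa].
- rewrite derD; apply: lie_span_D; apply: lie_span_br => //; exact: IHn.
- by rewrite linear0; apply: lie_span_0.
- by rewrite linearD; apply: lie_span_D.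
- by rewrite linearZ; apply: lie_span_Z.
Qed.

Lemma lieq_derivation n (Q := lieq (derived_ideal L n)) :
  exists2 E : {linear Q -> Q},
    lie_derivation E
    & forall u : L, E (lieq_pi _ u) = lieq_pi (derived_ideal L n) (D u).
Proof.
pose h (u : Q) : Q := lieq_pi _ (D (repr u)).
have hE t : h (lieq_pi _ t) = lieq_pi _ (D t).
  apply/lieq_piP; rewrite -linearB; apply: derived_series_derivation.
  exact: lieq_repr.
have hL : linear h.
  move=> c u v; elim/lieq_ind: u => s; elim/lieq_ind: v => t.
  by rewrite -lieq_piZ -lieq_piD !hE linearP lieq_piD lieq_piZ.
pose hLM := GRing.isLinear.Build K Q Q _ h hL.
pose E : {linear Q -> Q} := HB.pack h hLM.
exists E => [u v|z]; last exact: hE.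
elim/lieq_ind: u => s; elim/lieq_ind: v => t.
by rewrite /E /= -lieq_pi_lie !hE derD lieq_piD !lieq_pi_lie.
Qed.

End QuotientDerivation.

Section FreeMetabelian.
Variables (K : fieldType) (d : nat).

(* The index set 'I_(d + d) is shared by the free generators and by the
   polynomial variables: lshift d i stands for x_i and rshift d i for y_i. *)
Definition L2d : lieAlgType K := free_lie K 'I_(d + d).
Definition F2d : lieAlgType K := lieq (derived_ideal L2d 2).

Definition gen (k : 'I_(d + d)) : F2d := lieq_pi _ (fl_gen K k).
Definition gx (i : 'I_d) : F2d := gen (lshift d i).
Definition gy (i : 'I_d) : F2d := gen (rshift d i).

Definition F2d' : F2d -> Prop := derived_series F2d 1.

(* u (ad z_0)^(m 0) (ad z_1)^(m 1) and so on; the order of the factors is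
   irrelevant for u in F2d', where the operators ad z_k commute. *)
Definition ad_monomial (m : 'X_{1.. d + d}) (u : F2d) : F2d :=
  foldl (fun v k => iter (m k) (fun w => [~ w, gen k]) v) u
        (enum 'I_(d + d)).

Definition ad_action (u : F2d) (f : {mpoly K[d + d]}) : F2d :=
  \sum_(m <- msupp f) f@_m *: ad_monomial m u.

Inductive generated (A : {mpoly K[d + d]} -> Prop) (S : F2d -> Prop) :
    F2d -> Prop :=
| gen_S u of S u : generated A S u
| gen_0 : generated A S 0
| gen_D u v of generated A S u & generated A S v : generated A S (u + v)
| gen_act u f of generated A S u & A f : generated A S (ad_action u f).

(* Since a derivation is determined by its values on the generators, each of
   the two predicates below has exactly one solution; see ex_poly_delta and
   ex_lie_delta for existence. *)
Definition poly_delta (D : {linear {mpoly K[d + d]} -> {mpoly K[d + d]}}) :=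
  [/\ poly_derivation D,
      forall i : 'I_d, D 'X_(rshift d i) = 'X_(lshift d i)
    & forall i : 'I_d, D 'X_(lshift d i) = 0].

Definition lie_delta (D : {linear F2d -> F2d}) :=
  [/\ lie_derivation D,
      forall i : 'I_d, D (gy i) = gx i
    & forall i : 'I_d, D (gx i) = 0].

Lemma ex_poly_delta : exists D, poly_delta D.
Proof.
pose h (f : {mpoly K[d + d]}) : {mpoly K[d + d]} :=
  \sum_(i < d) 'X_(lshift d i) * f^`M(rshift d i).
have hL : linear h.
  move=> c u v; rewrite /h scaler_sumr -big_split; apply: eq_bigr => i _ /=.
  by rewrite linearP mulrDr scalerAr.
pose hLM := GRing.isLinear.Build K _ _ _ h hL.
pose D : {linear {mpoly K[d + d]} -> {mpoly K[d + d]}} := HB.pack h hLM.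
exists D; split=> [f g|i|i]; rewrite /D /= /h.
- rewrite mulr_suml mulr_sumr -big_split; apply: eq_bigr => i _ /=.
  by rewrite mderivM mulrDr; congr (_ + _); [exact: mulrA | exact: mulrCA].
- have U0 : (U_(rshift d i) - U_(rshift d i) = 0 :> 'X_{1.. d + d})%MM.
    by apply/mnmP=> k; rewrite !mnmE subnn.
  rewrite (bigD1 i) //= mderivX mnmE eqxx mulr1n big1 => [|j ji].
    by rewrite addr0 U0 mpolyX0 scale1r mulr1.
  rewrite mderivX mnmE eq_rshift eq_sym (negPf ji).
  by rewrite mulr0n scale0r mulr0.
- by apply: big1 => j _; rewrite mderivX mnmE eq_lrshift mulr0n scale0r mulr0.
Qed.

Lemma ex_lie_delta : exists D, lie_delta D.
Proof.
pose f (k : 'I_(d + d)) : L2d :=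
  match split k with inl _ => 0 | inr i => fl_gen K (lshift d i) end.
have [D derD DE] := free_lie_derivation f.
have [E derE EE] := lieq_derivation derD 2.
exists E; split=> // i; rewrite /gx /gy /gen EE DE /f.
  by rewrite (unsplitK (inr i)).
by rewrite (unsplitK (inl i)).
Qed.

Inductive generators : F2d -> Prop :=
| gen_xy i : generators [~ gx i, gy i]
| gen_xx (i j : 'I_d) of (i < j)%N : generators [~ gx i, gx j]
| gen_xy_sym (i j : 'I_d) of (i < j)%N :
    generators ([~ gx i, gy j] + [~ gx j, gy i])
| gen_deg3 (i p q : 'I_d) of (p < q)%N :
    generators ([~ gx i, gx p, gy q] - [~ gx i, gy p, gx q])
| gen_deg3_alt (i j k : 'I_d) of (i < j)%N & (j < k)%N :
    generators
      ([~ gx i, gx j, gy k] - [~ gx i, gx k, gy j] + [~ gx j, gx k, gy i])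
| gen_deg4 (i j p q : 'I_d) of (i < j)%N & (p < q)%N :
    generators
      ([~ gx i, gx p, gy j, gy q] + [~ gy i, gy p, gx j, gx q]
       - [~ gx i, gy p, gy j, gx q] - [~ gy i, gx p, gx j, gy q]).

End FreeMetabelian.

(* Main.v *)
Require Import Defs.
From HB Require Import structures.
From mathcomp Require Import all_boot all_algebra.
From mathcomp Require Import ssrAC ssrcomplements mpoly ring.

(** Write S for K[X_d, Y_d] and z_k for the generators, the x_i followed by the
    y_i.  The proof rests on two facts.

    First, constants can be lifted.  The Magnus representation attaches to u in
    the derived algebra its Fox derivatives, polynomials forming a 1-form
    sum_k (fox k u) dz_k on which delta acts as a Lie derivative (fox_delta).
    Poincare's homotopy recovers u from it: up to division by the degree,
    u = sum_(k, l) [z_k, z_l] (d/dz_l) (fox k u) (reconstruction).  The formula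
    is compatible with delta, so a constant u is the image of a constant of
    Lambda^2 (x) S, where Lambda^2 is spanned by the symbols [z_k, z_l].  It
    also shows that the Fox derivatives determine u (fox_inj), which reduces all
    identities in the derived algebra to polynomial ones.  As a module over
    delta, Lambda^2 is the sum of the lines of [x_i, y_j] + [x_j, y_i], killed
    by delta, and of the chains [y_i, y_j], [x_i, y_j] + [y_i, x_j], [x_i, x_j].  A
    constant in a chain tensored with S is determined by its coefficient f at
    [x_i, x_j], and the condition on f is delta^3 f = 0.

    Second, the kernel of delta^(n+1) on S is spanned over the constants by the
    monomials of degree at most n in the y_i (ker_iter_wd).  This follows by
    induction from a polarised Capelli identity (polarised_capelli), which
    writes b (a + n + 1) f, for f of degree a in the x_i and b in the y_i, as a
    combination of the minors x_i y_j - x_j y_i and of the y_i, with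
    coefficients of smaller y-degree in the same kernel, respectively in the kernel of
    delta^n.

    With n = 2, only f = 1, y_q and y_j y_q remain.  The first gives [x_i, x_j];
    the second gives the generators of degree three, up to multiples of the
    symmetric brackets [x_i, y_j] + [x_j, y_i] and after sorting out the order
    of the indices (generated_tripletY); the third is a combination of
    symmetric brackets times minors (triplet_deg4). *)

Set Implicit Arguments.
Unset Strict Implicit.
Unset Printing Implicit Defensive.

Import GRing.Theory.
Local Open Scope ring_scope.
Local Open Scope lie_scope.

(** * Linear maps determined on monomials *)

Section MonomialExtension.
Variables (K : fieldType) (n : nat) (V : lmodType K).
Implicit Types (m : 'X_{1..n}) (f g : {mpoly K[n]}).

Lemma mnm_ind (P : 'X_{1..n} -> Prop) :
  P 0%MM -> (forall m k, P m -> P (m + U_(k))%MM) -> forall m, P m.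
Proof.
move=> P0 PS m; have [N] := ubnP (mdeg m); elim: N m => // N IHN m ltN.
have [->//|m0] := eqVneq m 0%MM.
have [k mk] : exists k, m k != 0%N.
  apply/existsP; apply: contraNT m0 => /existsPn m0.
  by apply/eqP/mnmP => k; rewrite mnm0E; apply/eqP/negPn/m0.
rewrite -lep1mP in mk; rewrite -(submK mk); apply/PS/IHN.
rewrite -ltnS; apply: leq_trans ltN.
by rewrite -{2}(submK mk) mdegD mdeg1 addn1.
Qed.

Lemma mpoly_lin_ind (P : {mpoly K[n]} -> Prop) :
  (forall c f g, P f -> P g -> P (c *: f + g)) ->
  (forall m, P 'X_[m]) -> forall f, P f.
Proof.
move=> PD PX; elim/mpolyind => [|c m f _ _ Pf]; last exact: PD.
by rewrite -(addNr 'X_[0]) -scaleN1r; apply: PD.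
Qed.

Variable h : 'X_{1..n} -> V.

Definition monext f : V := \sum_(m <- msupp f) f@_m *: h m.

Lemma monextwE k f : (msize f <= k)%N ->
  monext f = \sum_(m : 'X_{1..n < k}) f@_m *: h m.
Proof.
move=> lek.
rewrite /monext (big_mksub 'X_{1..n < k}) ?msupp_uniq //=; last first.
  by move=> m /msize_mdeg_lt /leq_trans; apply.
by rewrite big_rmcond //= => m /memN_msupp_eq0 ->; rewrite scale0r.
Qed.

Fact monext_is_linear : linear monext.
Proof.
move=> c f g.
pose k := maxn (msize (c *: f + g)) (maxn (msize f) (msize g)).
have [le1 le2 le3] :
    [/\ msize (c *: f + g) <= k, msize f <= k & msize g <= k]%N.
  by rewrite /k !leq_max !leqnn !orbT.
rewrite !(monextwE (k := k)) // scaler_sumr -big_split /=.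
by apply: eq_bigr => m _; rewrite mcoeffD mcoeffZ scalerDl scalerA.
Qed.
HB.instance Definition _ :=
  GRing.isLinear.Build K {mpoly K[n]} V _ monext monext_is_linear.

Lemma monextX m : monext 'X_[m] = h m.
Proof. by rewrite /monext msuppX big_seq1 mcoeffX eqxx scale1r. Qed.

End MonomialExtension.

Section DiagonalMaps.
Variables (K : fieldType) (n : nat).
Implicit Types (m : 'X_{1..n}) (f g : {mpoly K[n]}) (phi : 'X_{1..n} -> K).

Definition diagmap phi : {mpoly K[n]} -> {mpoly K[n]} :=
  monext (fun m => phi m *: 'X_[m]).
HB.instance Definition _ phi := GRing.Linear.on (diagmap phi).

Lemma diagmapX phi m : diagmap phi 'X_[m] = phi m *: 'X_[m].
Proof. exact: monextX. Qed.

Lemma mcoeff_diagmap phi f m : (diagmap phi f)@_m = phi m * f@_m.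
Proof.
elim/mpoly_lin_ind: f => [c f g IHf IHg|m'].
  by rewrite linearP !mcoeffD !mcoeffZ IHf IHg mulrDr mulrCA.
rewrite diagmapX mcoeffZ mcoeffX.
by case: eqP => [->|_] //; rewrite !mulr0.
Qed.

Lemma euler_monomial k m :
  'X_k * 'X_[m]^`M(k) = (m k)%:R *: 'X_[m] :> {mpoly K[n]}.
Proof.
rewrite mderivX -scalerAr -mpolyXD addmC.
have [->|mk] := eqVneq (m k) 0%N; first by rewrite !scale0r.
by rewrite submK // lep1mP.
Qed.

End DiagonalMaps.

(** * Constants of the Weitzenboeck derivation *)

Section Weitzenboeck.
Variables (K : fieldType) (d : nat).
Hypothesis char0 : [pchar K] =i pred0.
Local Notation S := {mpoly K[d + d]}.
Implicit Types (f g : S) (i j : 'I_d) (m : 'X_{1..d + d}).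

Definition X_ i : S := 'X_(lshift d i).
Definition Y_ i : S := 'X_(rshift d i).
Definition dX i f : S := f^`M(lshift d i).
Definition dY i f : S := f^`M(rshift d i).
HB.instance Definition _ i :=
  GRing.isLinear.Build K S S _ (dX i) (@mderiv_is_linear _ _ (lshift d i)).
HB.instance Definition _ i :=
  GRing.isLinear.Build K S S _ (dY i) (@mderiv_is_linear _ _ (rshift d i)).

Lemma dXM i f g : dX i (f * g) = dX i f * g + f * dX i g.
Proof. exact: mderivM. Qed.
Lemma dYM i f g : dY i (f * g) = dY i f * g + f * dY i g.
Proof. exact: mderivM. Qed.

Lemma mderiv_var (k l : 'I_(d + d)) : ('X_k : S)^`M(l) = (k == l)%:R.
Proof.
rewrite mderivX mnm1E; case: eqP => [->|_]; last by rewrite scale0r.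
by rewrite scale1r -[X in (X - _)%MM]add0m addmK mpolyX0.
Qed.

Lemma dXX i j : dX i (X_ j) = (j == i)%:R.
Proof. by rewrite /dX mderiv_var eq_lshift. Qed.
Lemma dXY i j : dX i (Y_ j) = 0.
Proof. by rewrite /dX mderiv_var eq_rlshift. Qed.
Lemma dYX i j : dY i (X_ j) = 0.
Proof. by rewrite /dY mderiv_var eq_lrshift. Qed.
Lemma dYY i j : dY i (Y_ j) = (j == i)%:R.
Proof. by rewrite /dY mderiv_var eq_rshift. Qed.

Lemma dYdX i j f : dY i (dX j f) = dX j (dY i f).
Proof. exact: mderiv_comm. Qed.
Lemma dYdY i j f : dY i (dY j f) = dY j (dY i f).
Proof. exact: mderiv_comm. Qed.

(** The derivation delta of K[X_d, Y_d], one of Weitzenboeck's linear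
    locally nilpotent derivations. *)
Definition wd f : S := \sum_i X_ i * dY i f.

Fact wd_is_linear : linear wd.
Proof.
move=> c f g; rewrite /wd scaler_sumr -big_split; apply: eq_bigr => i _ /=.
by rewrite linearP mulrDr scalerAr.
Qed.
HB.instance Definition _ := GRing.isLinear.Build K S S _ wd wd_is_linear.

Lemma wdM f g : wd (f * g) = wd f * g + f * wd g.
Proof.
rewrite /wd mulr_suml mulr_sumr -big_split; apply: eq_bigr => i _ /=.
by rewrite dYM; ring.
Qed.

Lemma wdX i : wd (X_ i) = 0.
Proof. by rewrite /wd big1 // => j _; rewrite dYX mulr0. Qed.

Lemma wdY i : wd (Y_ i) = X_ i.
Proof.
rewrite /wd (bigD1 i) //= dYY eqxx mulr1 big1 ?addr0 // => j /negPf ji.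
by rewrite dYY eq_sym ji mulr0.
Qed.

Lemma wd_nat n : wd n%:R = 0.
Proof.
by rewrite /wd big1 // => i _; rewrite /dY -mpolyC_nat mderivC mulr0.
Qed.

Lemma dY_wd i f : dY i (wd f) = wd (dY i f).
Proof.
rewrite /wd linear_sum; apply: eq_bigr => j _ /=.
by rewrite dYM dYX mul0r add0r dYdY.
Qed.

Lemma dX_wd i f : dX i (wd f) = dY i f + wd (dX i f).
Proof.
rewrite /wd linear_sum /=.
under eq_bigr do rewrite dXM dXX -dYdX.
rewrite big_split /=; congr (_ + _).
rewrite (bigD1 i) //= eqxx mul1r big1 ?addr0 // => j /negPf ji.
by rewrite ji mul0r.
Qed.

Lemma poly_deltaE (D : {linear S -> S}) : poly_delta D -> D =1 wd.
Proof.
move=> [DM DY DX]; elim/mpoly_lin_ind => [c f g IHf IHg|m].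
  by rewrite !linearP IHf IHg.
have D1 : D 1 = 0.
  by have /eqP := DM 1 1; rewrite !(mulr1, mul1r) -subr_eq subrr => /eqP <-.
elim/mnm_ind: m => [|m k IHm].
  by rewrite mpolyX0 D1 (wd_nat 1).
rewrite mpolyXD DM wdM IHm; congr (_ + _ * _).
case: (split_ordP k) => i ->; first by rewrite DX -/(X_ i) wdX.
by rewrite DY -/(Y_ i) wdY.
Qed.

Definition minor i j : S := X_ i * Y_ j - X_ j * Y_ i.

(** The polarised operators Omega_ij of Cayley: they commute with the
    derivation because the pair dX i, dY i transforms like a plane vector. *)
Definition dminor i j f : S := dX i (dY j f) - dX j (dY i f).

Lemma wd_minor i j : wd (minor i j) = 0.
Proof. by rewrite /minor linearB /= !wdM !wdX !wdY; ring. Qed.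

Lemma wd_dminor i j f : wd (dminor i j f) = dminor i j (wd f).
Proof.
by rewrite /dminor linearB /= !dY_wd !dX_wd dYdY opprD addrACA subrr add0r.
Qed.

Definition euler_x f : S := \sum_i X_ i * dX i f.
Definition euler_y f : S := \sum_i Y_ i * dY i f.

Fact euler_x_is_linear : linear euler_x.
Proof.
move=> c f g; rewrite /euler_x scaler_sumr -big_split; apply: eq_bigr => i _ /=.
by rewrite linearP mulrDr scalerAr.
Qed.
HB.instance Definition _ :=
  GRing.isLinear.Build K S S _ euler_x euler_x_is_linear.

Fact euler_y_is_linear : linear euler_y.
Proof.
move=> c f g; rewrite /euler_y scaler_sumr -big_split; apply: eq_bigr => i _ /=.
by rewrite linearP mulrDr scalerAr.
Qed.
HB.instance Definition _ :=
  GRing.isLinear.Build K S S _ euler_y euler_y_is_linear.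

(** Capelli's identity for d + 1 plane vectors, read off on the leading
    coefficient of a form of degree n in the extra vector (s, t).  The form
    sum_k (-1)^k (wd^k f / k!) s^(n-k) t^k is killed by delta extended to s, t
    exactly when wd^(n+1) f = 0; on its coefficient of s^n the minors and
    Omega operators involving (s, t) become the operators
    Y_i (dX_i wd + n dY_i), and the term E_yx E_xy of Capelli's identity,
    which would spoil the induction in ker_iter_wd, cancels out.  Both sides
    are doubled because the minors are summed over ordered pairs. *)
Lemma polarised_capelli n f :
  \sum_i \sum_j minor i j * dminor i j f
    + (\sum_i Y_ i * (dX i (wd f) + dY i f *+ n)) *+ 2
  = (euler_x (euler_y f) + euler_y f *+ n.+1) *+ 2.
Proof.
pose a := \sum_i \sum_j X_ i * Y_ j * dX i (dY j f).
pose b := \sum_i \sum_j X_ i * Y_ j * dX j (dY i f).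
have -> : \sum_i \sum_j minor i j * dminor i j f = (a - b) *+ 2.
  have -> : (a - b) *+ 2 = (a - b) + (a - b) by [].
  rewrite {2}/a {2}/b [X in _ + (X - _)]exchange_big.
  rewrite [X in _ + (_ - X)]exchange_big.
  rewrite /a /b -!sumrB -big_split; apply: eq_bigr => i _ /=.
  rewrite -!sumrB -big_split; apply: eq_bigr => j _ /=.
  by rewrite /minor /dminor; ring.
have -> : euler_x (euler_y f) = a.
  apply: eq_bigr => i _; rewrite linear_sum mulr_sumr; apply: eq_bigr => j _ /=.
  by rewrite dXM dXY mul0r add0r mulrA.
have -> : \sum_i Y_ i * (dX i (wd f) + dY i f *+ n) = b + euler_y f *+ n.+1.
  rewrite /b exchange_big /euler_y -sumrMnl -big_split.
  apply: eq_bigr => i _ /=.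
  rewrite dX_wd mulrDr mulrDr /wd mulr_sumr.
  rewrite (eq_bigr (fun j => X_ j * Y_ i * dX i (dY j f))) => [|j _].
    by ring.
  by rewrite dYdX mulrA [Y_ i * _]mulrC.
by rewrite -mulrnDl addrA subrK.
Qed.

Definition xdeg m := (\sum_(i < d) m (lshift d i))%N.
Definition ydeg m := (\sum_(i < d) m (rshift d i))%N.

Lemma mdeg_xy m : mdeg m = (xdeg m + ydeg m)%N.
Proof. by rewrite mdegE big_split_ord. Qed.

(** Diagonal maps depending on the bidegree only: multiplication by a scalar
    on each bihomogeneous component, so that inverting a function of the Euler
    operators needs no decomposition into components. *)
Definition bidiag (phi : nat -> nat -> K) : S -> S :=
  diagmap (fun m => phi (xdeg m) (ydeg m)).
HB.instance Definition _ phi := GRing.Linear.on (bidiag phi).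

Lemma bidiagX phi m : bidiag phi 'X_[m] = phi (xdeg m) (ydeg m) *: 'X_[m].
Proof. exact: diagmapX. Qed.

Lemma mcoeff_bidiag phi f m : (bidiag phi f)@_m = phi (xdeg m) (ydeg m) * f@_m.
Proof. exact: mcoeff_diagmap. Qed.

Lemma euler_xE f : euler_x f = bidiag (fun a _ => a%:R) f.
Proof.
elim/mpoly_lin_ind: f => [c f g IHf IHg|m].
  by rewrite !linearP /= IHf IHg.
rewrite bidiagX /xdeg natr_sum scaler_suml; apply: eq_bigr => i _.
exact: euler_monomial.
Qed.

Lemma euler_yE f : euler_y f = bidiag (fun _ b => b%:R) f.
Proof.
elim/mpoly_lin_ind: f => [c f g IHf IHg|m].
  by rewrite !linearP /= IHf IHg.
rewrite bidiagX /ydeg natr_sum scaler_suml; apply: eq_bigr => i _.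
exact: euler_monomial.
Qed.

Lemma xdegD m m' : xdeg (m + m')%MM = (xdeg m + xdeg m')%N.
Proof. by rewrite /xdeg -big_split; apply: eq_bigr => i _; rewrite mnmDE. Qed.
Lemma ydegD m m' : ydeg (m + m')%MM = (ydeg m + ydeg m')%N.
Proof. by rewrite /ydeg -big_split; apply: eq_bigr => i _; rewrite mnmDE. Qed.

Lemma xdegU i : (xdeg U_(lshift d i) = 1%N) * (xdeg U_(rshift d i) = 0%N).
Proof.
split; rewrite /xdeg; last first.
  by rewrite big1 // => j _; rewrite mnm1E eq_rlshift.
rewrite (bigD1 i) //= mnm1E eqxx big1 // => j /negPf ji.
by rewrite mnm1E eq_lshift eq_sym ji.
Qed.
Lemma ydegU i : (ydeg U_(lshift d i) = 0%N) * (ydeg U_(rshift d i) = 1%N).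
Proof.
split; rewrite /ydeg.
  by rewrite big1 // => j _; rewrite mnm1E eq_lrshift.
rewrite (bigD1 i) //= mnm1E eqxx big1 // => j /negPf ji.
by rewrite mnm1E eq_rshift eq_sym ji.
Qed.

(** The derivation moves bidegree (a, b + 1) to (a + 1, b). *)
Lemma wd_bidiag phi psi f : (forall a b, psi a.+1 b = phi a b.+1) ->
  wd (bidiag phi f) = bidiag psi (wd f).
Proof.
move=> phi_psi.
elim/mpoly_lin_ind: f => [c f g IHf IHg|m].
  by rewrite !linearP /= IHf IHg.
rewrite bidiagX linearZ /= /wd scaler_sumr linear_sum; apply: eq_bigr => i _ /=.
rewrite /dY mderivX -!scalerAr -mpolyXD [bidiag _ (_ *: _)]linearZ /= bidiagX.
have [->|mi] := eqVneq (m (rshift d i)) 0%N; first by rewrite !scale0r scaler0.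
rewrite -lep1mP in mi; rewrite -{1 2}(submK mi) !(xdegD, ydegD, xdegU, ydegU).
by rewrite addn0 addn1 add1n add0n phi_psi !scalerA mulrC.
Qed.

Lemma iter_wd_bidiag n phi f :
  iter n wd f = 0 -> iter n wd (bidiag phi f) = 0.
Proof.
suff [phi' ->] :
    exists phi', iter n wd (bidiag phi f) = bidiag phi' (iter n wd f).
  by move=> ->; rewrite linear0.
elim: n => [|n [phi' IHn]]; first by exists phi.
by exists (fun a b => phi' a.-1 b.+1); rewrite !iterS IHn; apply: wd_bidiag.
Qed.

Definition ydeg_lt (b : nat) f := forall m, (b <= ydeg m)%N -> f@_m = 0.

Lemma ydeg_lt_exists f : exists b, ydeg_lt b f.
Proof.
exists (msize f) => m le_m; apply/memN_msupp_eq0/msize_mdeg_ge.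
by apply: leq_trans le_m _; rewrite mdeg_xy leq_addl.
Qed.

Lemma ydeg_lt_bidiag b phi f : ydeg_lt b f -> ydeg_lt b (bidiag phi f).
Proof. by move=> ltf m le_m; rewrite mcoeff_diagmap ltf ?mulr0. Qed.

Lemma ydeg_lt_dminor b i j f : ydeg_lt b.+1 f -> ydeg_lt b (dminor i j f).
Proof.
move=> ltf m le_m; rewrite mcoeffB !mcoeff_mderiv !ltf ?mul0rn ?subr0 //.
all: by rewrite !ydegD !ydegU addn0 addn1 ltnS.
Qed.

(** The span over the constants of wd of the monomials of degree at most n
    in the y variables, in the nested form produced by ker_iter_wd. *)
Fixpoint yspan (n : nat) f : Prop :=
  if n is n'.+1 then
    exists g0 (g : 'I_d -> S),
      [/\ wd g0 = 0, forall i, yspan n' (g i) & f = g0 + \sum_i Y_ i * g i]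
  else wd f = 0.

Lemma yspanD n f g : yspan n f -> yspan n g -> yspan n (f + g).
Proof.
elim: n f g => [|n IHn] f g /=.
  by move=> f0 g0; rewrite linearD /= f0 g0 addr0.
move=> [f0 [f1 [wf0 wf1 ->]]] [g0 [g1 [wg0 wg1 ->]]].
exists (f0 + g0), (fun i => f1 i + g1 i); split=> [|i|].
- by rewrite linearD /= wf0 wg0 addr0.
- exact: IHn.
- rewrite addrACA -big_split; congr (_ + _); apply: eq_bigr => i _.
  by rewrite mulrDr.
Qed.

Lemma yspanM n c f : wd c = 0 -> yspan n f -> yspan n (c * f).
Proof.
move=> wc; elim: n f => [|n IHn] f /=.
  by move=> wf; rewrite wdM wc wf; ring.
move=> [f0 [f1 [wf0 wf1 ->]]].
exists (c * f0), (fun i => c * f1 i); split=> [|i|].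
- by rewrite wdM wc wf0; ring.
- exact: IHn.
- rewrite mulrDr mulr_sumr; congr (_ + _); apply: eq_bigr => i _; ring.
Qed.

Lemma yspan_const n f : wd f = 0 -> yspan n f.
Proof.
elim: n f => [//|n IHn] f wf /=; exists f, (fun=> 0); split=> // [i|].
  by apply: IHn; rewrite linear0.
by rewrite big1 ?addr0 // => i _; rewrite mulr0.
Qed.

Lemma yspan_sum n (I : Type) (r : seq I) (P : pred I) (F : I -> S) :
  (forall k, P k -> yspan n (F k)) -> yspan n (\sum_(k <- r | P k) F k).
Proof.
move=> PF; elim/big_ind: _ => //; last exact: yspanD.
by apply: yspan_const; rewrite linear0.
Qed.

Lemma yspanZ n c f : yspan n f -> yspan n (c *: f).
Proof.
rewrite -mul_mpolyC; apply: yspanM; rewrite /wd big1 // => i _.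
by rewrite /dY mderivC mulr0.
Qed.

Lemma natr_neq0 n : (n.+1%:R : K) != 0.
Proof. by rewrite ((pcharf0P K).1 char0). Qed.

Lemma iter_wd_dY n i f : iter n wd (dY i f) = dY i (iter n wd f).
Proof. by elim: n => //= n ->; rewrite dY_wd. Qed.

Lemma iter_wd_dX n i f :
  iter n.+1 wd (dX i f) = dX i (iter n.+1 wd f) - dY i (iter n wd f) *+ n.+1.
Proof.
have wd_dX g : wd (dX i g) = dX i (wd g) - dY i g by rewrite dX_wd addrC addKr.
elim: n => [|n IHn]; first by rewrite /= wd_dX.
rewrite iterS IHn linearB /= linearMn /= wd_dX -dY_wd.
by rewrite -addrA -opprD -mulrS.
Qed.

(** Let f0 be the part of f free of the y variables, which is constant, and let
    f' be f divided by b (a + n + 1) on each component of y-degree b > 0.  The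
    Capelli identity at f' expresses 2 (f - f0).  There the dminor i j f' still
    lie in the kernel of the (n+1)-st iterate and have smaller y-degree, and
    the coefficients of the Y_i lie in the kernel of the n-th iterate. *)
Lemma ker_iter_wd n f : iter n.+1 wd f = 0 -> yspan n f.
Proof.
elim: n f => [//|N IHN] f; set n := N.+1 => wf.
have [b] := ydeg_lt_exists f; elim: b f wf => [|b IHb] f wf ltf.
  suff -> : f = 0 by apply: yspan_const; rewrite linear0.
  by apply/mpolyP => m; rewrite ltf // mcoeff0.
pose phi a b := (b * (a + n.+1))%:R^-1 : K; pose f' := bidiag phi f.
have wf' : iter n.+1 wd f' = 0 by apply: iter_wd_bidiag.
pose f0 := bidiag (fun _ b => (b == 0%N)%:R) f.
have wf0 : wd f0 = 0.
  by rewrite (wd_bidiag (psi := fun _ _ => 0)) //; apply/mpolyP => m;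
    rewrite mcoeff_bidiag mul0r mcoeff0.
have ff' : f = f0 + (euler_x (euler_y f') + euler_y f' *+ n.+1).
  apply/mpolyP => m; rewrite euler_xE !euler_yE.
  rewrite mcoeffD [X in _ + X]mcoeffD mcoeffMn !mcoeff_bidiag /phi.
  case: (ydeg m) => [|b']; first by rewrite !mul0r mulr0 mul0rn !addr0 mul1r.
  set c := (b'.+1 * (xdeg m + n.+1))%:R.
  have c0 : c != 0 by rewrite /c addnS mulnS natr_neq0.
  rewrite mul0r add0r -mulr_natl -[LHS](mulVKf c0) {1}/c natrM natrD; ring.
have /(congr1 (fun g => f0 *+ 2 + g)) := polarised_capelli n f'.
rewrite -mulrnDl -ff' => Ef2.
have {Ef2} -> : f = 2%:R^-1 *: (\sum_i \sum_j minor i j * dminor i j f')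
                 + (f0 + \sum_i Y_ i * (dX i (wd f') + dY i f' *+ n)).
  apply: (scalerI (natr_neq0 1)); rewrite scaler_nat -Ef2.
  rewrite scalerDr scalerA divff ?natr_neq0 // scale1r scaler_nat.
  by rewrite addrCA mulrnDl.
apply: yspanD.
  apply/yspanZ/yspan_sum => i _; apply: yspan_sum => j _.
  apply: yspanM; first exact: wd_minor.
  apply: IHb; last exact/ydeg_lt_dminor/ydeg_lt_bidiag.
  have iter_dminor k g : iter k wd (dminor i j g) = dminor i j (iter k wd g).
    by elim: k => //= k ->; rewrite wd_dminor.
  by rewrite iter_dminor wf' /dminor /dX /dY !mderiv0 subr0.
exists f0, (fun i => dX i (wd f') + dY i f' *+ n); split=> // i; apply: IHN.
have iterD g h : iter n wd (g + h) = iter n wd g + iter n wd h.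
  by elim: (n) => //= k ->; rewrite linearD.
have iterMn g : iter n wd (g *+ n) = iter n wd g *+ n.
  by elim: (n) {2 4}n => //= k IHk p; rewrite IHk linearMn.
rewrite iterD iterMn iter_wd_dX iter_wd_dY -!iterSr wf' linear0 sub0r.
by rewrite addNr.
Qed.

End Weitzenboeck.

Arguments X_ {K d} i.
Arguments Y_ {K d} i.
Arguments minor {K d} i j.

(** * The module structure of the derived algebra *)

Section MetabelianAction.
Variables (K : fieldType) (d : nat).
Local Notation S := {mpoly K[d + d]}.
Local Notation F := (F2d K d).
Local Notation z := (gen K).
Implicit Types (u v w : F) (f g : S) (m : 'X_{1..d + d}) (k l : 'I_(d + d)).

Lemma F2d_ind (P : F -> Prop) :
  P 0 -> (forall k, P (z k)) -> (forall u v, P u -> P v -> P (u + v)) ->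
  (forall c u, P u -> P (c *: u)) ->
  (forall u v, P u -> P v -> P [~ u, v]) -> forall u, P u.
Proof.
move=> P0 Pz PD PZ PB; elim/lieq_ind; elim/fl_ind.
elim=> [k||s IHs t IHt|c s IHs|s IHs t IHt].
- exact: Pz.
- exact: P0.
- by rewrite fl_piD lieq_piD; apply: PD.
- by rewrite fl_piZ lieq_piZ; apply: PZ.
- by rewrite fl_pi_lie lieq_pi_lie; apply: PB.
Qed.

Lemma derived_lift u :
  F2d' u -> exists2 a : L2d K d, derived_series _ 1 a & u = lieq_pi _ a.
Proof.
elim=> [|||c] {u}.
- elim/lieq_ind=> a; elim/lieq_ind=> b _ _.
  by exists [~ a, b]; [apply: lie_span_br | rewrite lieq_pi_lie].
- by exists 0 => //; apply: lie_span_0.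
- move=> _ _ _ [a Da ->] _ [b Db ->].
  by exists (a + b); [apply: lie_span_D | rewrite lieq_piD].
- move=> _ _ [a Da ->].
  by exists (c *: a); [apply: lie_span_Z | rewrite lieq_piZ].
Qed.

Lemma lie_derived0 u v : F2d' u -> F2d' v -> [~ u, v] = 0.
Proof.
move=> /derived_lift[a Da ->] /derived_lift[b Db ->].
rewrite -lieq_pi_lie; apply/lieq_piP; rewrite subr0.
exact: lie_span_br.
Qed.

Lemma derived_lie u v : F2d' [~ u, v].
Proof. exact: lie_span_br. Qed.

Lemma derived_0 : F2d' (0 : F).
Proof. exact: lie_span_0. Qed.

Lemma derived_D u v : F2d' u -> F2d' v -> F2d' (u + v).
Proof. exact: lie_span_D. Qed.

Lemma derived_Z c u : F2d' u -> F2d' (c *: u).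
Proof. exact: lie_span_Z. Qed.

Lemma derived_B u v : F2d' u -> F2d' v -> F2d' (u - v).
Proof. by move=> Du Dv; rewrite -scaleN1r; apply/derived_D/derived_Z. Qed.

Lemma derived_sum (I : Type) (r : seq I) (P : pred I) (G : I -> F) :
  (forall i, P i -> F2d' (G i)) -> F2d' (\sum_(i <- r | P i) G i).
Proof.
by move=> DG; elim/big_ind: _ => //; [apply: derived_0 | apply: derived_D].
Qed.

(** The metabelian identity. *)
Lemma lie_derivedC u v w : F2d' u -> [~ u, v, w] = [~ u, w, v].
Proof.
by move=> Du; rewrite lie_leibniz (lie_derived0 Du (derived_lie v w)) addr0.
Qed.

Lemma ad_monomial_linear m : linear (@ad_monomial K d m).
Proof.
move=> c u v; rewrite /ad_monomial; elim: (enum _) u v => //= k s IHs u v.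
rewrite -IHs; congr foldl; elim: (m k) => //= n ->.
by rewrite lieDl lieZl.
Qed.
HB.instance Definition _ m :=
  GRing.isLinear.Build K F F _ (ad_monomial m) (ad_monomial_linear m).

Lemma ad_monomial0 u : ad_monomial 0 u = u.
Proof.
by rewrite /ad_monomial; elim: (enum _) u => //= k s IHs u; rewrite mnm0E.
Qed.

Lemma ad_monomialS m k u :
  F2d' u -> ad_monomial (m + U_(k)) u = [~ ad_monomial m u, z k].
Proof.
pose T (m : 'X_{1..d + d}) s u :=
  foldl (fun v k => iter (m k) (fun w => [~ w, z k]) v) u s.
have iterC n l v w : F2d' w ->
    F2d' (iter n (fun w => [~ w, z l]) w) /\
    iter n (fun w => [~ w, z l]) [~ w, v]
      = [~ iter n (fun w => [~ w, z l]) w, v].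
  move=> Dw; elim: n => //= n [Dn ->].
  by split; [apply: derived_lie | rewrite lie_derivedC].
have TC s v w : F2d' w -> T m s [~ w, v] = [~ T m s w, v].
  elim: s w => //= l s IHs w Dw.
  by have [Dl ->] := iterC (m l) l v w Dw; rewrite IHs.
have Tnotin s w : k \notin s -> T (m + U_(k))%MM s w = T m s w.
  elim: s w => //= l s IHs w; rewrite inE negb_or => /andP[kl ks].
  by rewrite mnmDE mnm1E (negPf kl) addn0 IHs.
have Tin s w : F2d' w -> k \in s -> uniq s ->
    T (m + U_(k))%MM s w = [~ T m s w, z k].
  elim: s w => //= l s IHs w Dw; rewrite inE => kls /andP[ls us].
  have [kl|kl] := eqVneq k l.
    rewrite -kl in ls *; rewrite mnmDE mnm1E eqxx addn1 /= Tnotin // TC //.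
    by have [] := iterC (m k) k 0 w Dw.
  rewrite mnmDE mnm1E (negPf kl) addn0; move: kls; rewrite (negPf kl) /= => ks.
  by apply: IHs => //; have [] := iterC (m l) l 0 w Dw.
by move=> Du; apply: Tin; rewrite ?mem_enum ?enum_uniq.
Qed.

Lemma derived_ad_monomial m u : F2d' u -> F2d' (ad_monomial m u).
Proof.
move=> Du; elim/mnm_ind: m => [|m k IHm]; first by rewrite ad_monomial0.
by rewrite ad_monomialS //; apply: derived_lie.
Qed.

Lemma ad_monomialD m1 m2 u :
  F2d' u -> ad_monomial (m1 + m2) u = ad_monomial m2 (ad_monomial m1 u).
Proof.
move=> Du; elim/mnm_ind: m2 => [|m k IHm]; first by rewrite addm0 ad_monomial0.
rewrite addmA !ad_monomialS ?IHm //; exact: derived_ad_monomial.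
Qed.

Fact ad_action_linear u : linear (ad_action u).
Proof. exact: monext_is_linear. Qed.
HB.instance Definition _ u :=
  GRing.isLinear.Build K S F _ (ad_action u) (ad_action_linear u).

Lemma ad_actionX u m : ad_action u 'X_[m] = ad_monomial m u.
Proof. exact: monextX. Qed.

Lemma ad_action1 u : ad_action u 1 = u.
Proof. by rewrite -mpolyX0 ad_actionX ad_monomial0. Qed.

Lemma ad_actionU u k : F2d' u -> ad_action u 'X_k = [~ u, z k].
Proof.
move=> Du.
by rewrite ad_actionX -[U_(k)%MM]add0m ad_monomialS ?ad_monomial0.
Qed.

Fact ad_actionPl f : linear (fun u => ad_action u f).
Proof.
move=> c u v; rewrite /ad_action scaler_sumr -big_split.
apply: eq_bigr => m _ /=.
by rewrite linearP scalerDr !scalerA mulrC.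
Qed.
Lemma ad_action0l f : ad_action 0 f = 0.
Proof. by have := ad_actionPl f (-1) 0 0; rewrite !scaleN1r !addNr. Qed.

Lemma ad_actionZl c u f : ad_action (c *: u) f = c *: ad_action u f.
Proof. by have := ad_actionPl f c u 0; rewrite /= ad_action0l !addr0. Qed.

Lemma ad_actionDl u v f : ad_action (u + v) f = ad_action u f + ad_action v f.
Proof. by have := ad_actionPl f 1 u v; rewrite /= !scale1r. Qed.

Lemma derived_ad_action u f : F2d' u -> F2d' (ad_action u f).
Proof.
by move=> Du; apply: derived_sum => m _; apply/derived_Z/derived_ad_monomial.
Qed.

Lemma ad_actionM u f g :
  F2d' u -> ad_action u (f * g) = ad_action (ad_action u f) g.
Proof.
move=> Du; elim/mpoly_lin_ind: f => [c f1 f2 IH1 IH2|m1].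
  by rewrite mulrDl -scalerAl !linearP /= ad_actionDl ad_actionZl IH1 IH2.
elim/mpoly_lin_ind: g => [c g1 g2 IH1 IH2|m2].
  by rewrite mulrDr -scalerAr !linearP /= IH1 IH2.
by rewrite -mpolyXD !ad_actionX ad_monomialD.
Qed.

(** Equal to the derived algebra (derived_brspan); it serves as an induction
    principle, reducing linear identities to the elements [z_k, z_l] acted on
    by a monomial. *)
Inductive brspan : F -> Prop :=
| brspan_0 : brspan 0
| brspan_lin c u v of brspan u & brspan v : brspan (c *: u + v)
| brspan_br k l m : brspan (ad_action [~ z k, z l] 'X_[m]).

Lemma brspanZ c u : brspan u -> brspan (c *: u).
Proof. by move=> Bu; rewrite -[_ *: _]addr0; apply: brspan_lin Bu brspan_0. Qed.

Lemma brspanD u v : brspan u -> brspan v -> brspan (u + v).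
Proof. by rewrite -{2}[u]scale1r; apply: brspan_lin. Qed.

Lemma brspan_derived u : brspan u -> F2d' u.
Proof.
elim=> [|c v w _ Dv _ Dw|k l m]; first exact: derived_0.
  exact/derived_D/Dw/derived_Z.
exact/derived_ad_action/derived_lie.
Qed.

Lemma brspan_lie u v : brspan u -> brspan [~ u, v].
Proof.
move=> Bu; elim/F2d_ind: v => [|k|v w Bv Bw|c v Bv|v w _ _].
- by rewrite lie0r; apply: brspan_0.
- elim: Bu => [|c v w _ Bv _ Bw|k' l m].
  + by rewrite lie0l; apply: brspan_0.
  + by rewrite lieDl lieZl; apply: brspan_lin.
  + rewrite ad_actionX -ad_monomialS -?ad_actionX; first exact: brspan_br.
    exact: derived_lie.
- by rewrite lieDr; apply: brspanD.
- by rewrite lieZr; apply: brspanZ.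
- rewrite (lie_derived0 (brspan_derived Bu) (derived_lie v w)).
  exact: brspan_0.
Qed.

Inductive linspan : F -> Prop :=
| linspan_0 : linspan 0
| linspan_lin c u v of linspan u & linspan v : linspan (c *: u + v)
| linspan_z k : linspan (z k).

Lemma brspan_lin_lie u v : linspan u -> linspan v -> brspan [~ u, v].
Proof.
elim=> [|c u1 u2 _ IH1 _ IH2|k] Lv.
- by rewrite lie0l; apply: brspan_0.
- by rewrite lieDl lieZl; apply: brspan_lin; auto.
- elim: Lv => [|c v1 v2 _ IH1 _ IH2|l].
  + by rewrite lie0r; apply: brspan_0.
  + by rewrite lieDr lieZr; apply: brspan_lin.
  + rewrite -[X in brspan X]ad_action1 -mpolyX0; exact: brspan_br.
Qed.

Lemma brspan_lie_mod u v a b :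
  linspan a -> brspan (u - a) -> linspan b -> brspan (v - b) -> brspan [~ u, v].
Proof.
move=> La Bu Lb Bv.
rewrite -[u](subrK a) lieDl; apply: brspanD; first exact: brspan_lie.
rewrite -[v](subrK b) lieDr; apply: brspanD; last exact: brspan_lin_lie.
by rewrite lie_anti -scaleN1r; apply/brspanZ/brspan_lie.
Qed.

(** The induction over Lie terms has to treat a whole bracket [u, v] of terms,
    so u and v are first reduced modulo brspan to combinations of
    generators. *)
Lemma lin_br_decomposition u : exists2 a, linspan a & brspan (u - a).
Proof.
elim/F2d_ind: u =>
  [|k|u v [a La Bu] [b Lb Bv]|c u [a La Bu]|u v [a La Bu] [b Lb Bv]].
- by exists 0; [apply: linspan_0 | rewrite subrr; apply: brspan_0].
- by exists (z k); [apply: linspan_z | rewrite subrr; apply: brspan_0].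
- exists (a + b); first by rewrite -[a]scale1r; apply: linspan_lin.
  by rewrite opprD addrACA; apply: brspanD.
- exists (c *: a).
    by rewrite -[_ *: _]addr0; apply: linspan_lin La linspan_0.
  by rewrite -scalerBr; apply: brspanZ.
- exists 0; first exact: linspan_0.
  by rewrite subr0; apply: brspan_lie_mod La Bu Lb Bv.
Qed.

Lemma derived_brspan u : F2d' u -> brspan u.
Proof.
elim=> [v w _ _||v w _ Bv _ Bw|c v _ Bv].
- have [a La Bv] := lin_br_decomposition v.
  by have [b Lb Bw] := lin_br_decomposition w; apply: brspan_lie_mod La Bv Lb Bw.
- exact: brspan_0.
- exact: brspanD.
- exact: brspanZ.
Qed.

Variable D : {linear F -> F}.
Hypothesis D_delta : lie_delta D.

Lemma delta_derived u : F2d' u -> F2d' (D u).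
Proof.
have [DB _ _] := D_delta.
elim=> [v w _ _||v w _ Dv _ Dw|c v _ Dv].
- by rewrite DB; apply: derived_D; apply: derived_lie.
- by rewrite linear0; apply: derived_0.
- by rewrite linearD; apply: derived_D.
- by rewrite linearZ; apply: derived_Z.
Qed.

Lemma delta_ad_action u f :
  F2d' u -> D (ad_action u f) = ad_action (D u) f + ad_action u (wd f).
Proof.
move=> Du; have [DB DY DX] := D_delta; have DDu := delta_derived Du.
elim/mpoly_lin_ind: f => [c f g IHf IHg|m].
  by rewrite !linearP /= IHf IHg scalerDr addrACA.
elim/mnm_ind: m => [|m k IHm].
  by rewrite mpolyX0 !ad_action1 (wd_nat K d 1) linear0 addr0.
rewrite mpolyXD wdM linearD /= !ad_actionM // !ad_actionU;
  try exact: derived_ad_action.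
rewrite DB IHm lieDl -!addrA; congr (_ + (_ + _)).
case: (split_ordP k) => i ->.
  by rewrite -/(X_ i) wdX linear0 DX lie0r.
by rewrite -/(Y_ i) wdY ad_actionU ?DY //; apply: derived_ad_action.
Qed.

End MetabelianAction.

(** * The Magnus representation *)

Section MagnusAlgebra.
Variables (K : fieldType) (n : nat).
Local Notation S := {mpoly K[n]}.

Definition magnus : Type := (S * {ffun 'I_n -> S})%type.
HB.instance Definition _ := GRing.Lmodule.on magnus.

(** The semidirect product of the abelian Lie algebra K[Z] with the free module
    K[Z]^n, on which it acts by multiplication.  It is metabelian, so sending
    z_k to the pair of the variable and the k-th basis vector is well defined
    on the free metabelian algebra. *)
Definition magnus_lie (a b : magnus) : magnus :=
  (0, [ffun k => b.1 * a.2 k - a.1 * b.2 k]).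

Lemma magnusP (a b : magnus) : a.1 = b.1 -> (forall k, a.2 k = b.2 k) -> a = b.
Proof. by case: a b => [p v] [q w] /= -> vw; congr pair; apply/ffunP. Qed.

Fact magnus_lieDl a b c : magnus_lie (a + b) c = magnus_lie a c + magnus_lie b c.
Proof. by apply: magnusP => [|k] /=; rewrite ?addr0 // !ffunE; ring. Qed.
Fact magnus_lieDr a b c : magnus_lie a (b + c) = magnus_lie a b + magnus_lie a c.
Proof. by apply: magnusP => [|k] /=; rewrite ?addr0 // !ffunE; ring. Qed.
Fact magnus_lieZl (x : K) a b : magnus_lie (x *: a) b = x *: magnus_lie a b.
Proof.
apply: magnusP => [|k] /=; rewrite ?scaler0 // !ffunE.
by rewrite -!mul_mpolyC; ring.
Qed.
Fact magnus_lieZr (x : K) a b : magnus_lie a (x *: b) = x *: magnus_lie a b.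
Proof.
apply: magnusP => [|k] /=; rewrite ?scaler0 // !ffunE.
by rewrite -!mul_mpolyC; ring.
Qed.
Fact magnus_liexx a : magnus_lie a a = 0.
Proof. by apply: magnusP => [|k] //=; rewrite !ffunE; ring. Qed.
Fact magnus_jacobi a b c :
  magnus_lie (magnus_lie a b) c + magnus_lie (magnus_lie b c) a
    + magnus_lie (magnus_lie c a) b = 0.
Proof. by apply: magnusP => [|k] /=; rewrite ?addr0 // !ffunE; ring. Qed.

HB.instance Definition _ :=
  Lmodule_isLie.Build K magnus magnus_lieDl magnus_lieDr magnus_lieZl
    magnus_lieZr magnus_liexx magnus_jacobi.

Lemma magnus_lieE (a b : magnus) : [~ a, b] = magnus_lie a b.
Proof. by []. Qed.

Lemma magnus_derived1 (a : magnus) : derived_series magnus 1 a -> a.1 = 0.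
Proof.
elim=> [b c _ _||b c _ b0 _ c0|x b _ b0] //=; first by rewrite b0 c0 addr0.
by rewrite b0 scaler0.
Qed.

Lemma magnus_derived2 (a : magnus) : derived_series magnus 2 a -> a = 0.
Proof.
elim=> [b c /magnus_derived1 b0 /magnus_derived1 c0||b c _ -> _ ->|x b _ ->] //.
- by apply: magnusP => [|k] //=; rewrite !ffunE b0 c0 !mul0r subrr.
- by rewrite addr0.
- by rewrite scaler0.
Qed.

End MagnusAlgebra.

Section MagnusMap.
Variables (K : fieldType) (d : nat).
Local Notation S := {mpoly K[d + d]}.
Local Notation F := (F2d K d).
Local Notation B := (magnus K (d + d)).
Local Notation z := (gen K).
Implicit Types (u v w : F) (f g : S) (m : 'X_{1..d + d}) (k l : 'I_(d + d)).

Definition magnus_gen k : B := ('X_k, [ffun l => (l == k)%:R]).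

(** The doubled repr undoes both quotients: the one by the second derived ideal
    and the one presenting the free Lie algebra. *)
Definition magnus_map u : B := lie_eval magnus_gen (repr (repr u)).

Lemma magnus_map_pi t : magnus_map (lieq_pi _ (fl_pi t)) = lie_eval magnus_gen t.
Proof.
pose h (x : L2d K d) : B := lie_eval magnus_gen (repr x).
have hE s : h (fl_pi s) = lie_eval magnus_gen s by apply/lie_eval_eq/fl_repr.
have hD x y : h (x + y) = h x + h y.
  by elim/fl_ind: x => s; elim/fl_ind: y => r; rewrite -fl_piD !hE.
have hZ c x : h (c *: x) = c *: h x.
  by elim/fl_ind: x => s; rewrite -fl_piZ !hE.
have hB x y : h [~ x, y] = [~ h x, h y].
  by elim/fl_ind: x => s; elim/fl_ind: y => r; rewrite -fl_pi_lie !hE.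
have h0 : h 0 = 0 by rewrite hE.
have hder i x : derived_series _ i x -> derived_series B i (h x).
  elim: i x => //= i IHi x; elim=> [a b Da Db||a b _ Da _ Db|c a _ Da].
  - by rewrite hB; apply: lie_span_br; apply: IHi.
  - by rewrite h0; apply: lie_span_0.
  - by rewrite hD; apply: lie_span_D.
  - by rewrite hZ; apply: lie_span_Z.
rewrite -[magnus_map _]/(h (repr _)) -hE; apply/eqP.
rewrite -subr_eq0 -scaleN1r -hZ -hD scaleN1r; apply/eqP.
apply: magnus_derived2; apply: (hder 2).
exact: (@lieq_repr _ _ (derived_ideal (L2d K d) 2)).
Qed.

Fact magnus_map_linear : linear magnus_map.
Proof.
move=> c; elim/lieq_ind; elim/fl_ind=> s; elim/lieq_ind; elim/fl_ind=> t.
by rewrite -lieq_piZ -lieq_piD -fl_piZ -fl_piD !magnus_map_pi.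
Qed.
HB.instance Definition _ :=
  GRing.isLinear.Build K F B _ magnus_map magnus_map_linear.

Lemma magnus_map_lie u v : magnus_map [~ u, v] = [~ magnus_map u, magnus_map v].
Proof.
elim/lieq_ind: u; elim/fl_ind=> s; elim/lieq_ind: v; elim/fl_ind=> t.
by rewrite -lieq_pi_lie -fl_pi_lie !magnus_map_pi.
Qed.

Lemma magnus_map_gen k : magnus_map (z k) = magnus_gen k.
Proof. by rewrite magnus_map_pi. Qed.

Lemma magnus_map_derived u : F2d' u -> (magnus_map u).1 = 0.
Proof.
move=> Du; apply: magnus_derived1.
elim: Du => [a b _ _||a b _ Da _ Db|c a _ Da].
- by rewrite magnus_map_lie; apply: lie_span_br.
- by rewrite linear0; apply: lie_span_0.
- by rewrite linearD; apply: lie_span_D.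
- by rewrite linearZ; apply: lie_span_Z.
Qed.

(** The k-th Fox derivative of u. *)
Definition fox k u : S := (magnus_map u).2 k.

Fact fox_is_linear k : linear (fox k).
Proof. by move=> c u v; rewrite /fox linearP /= !ffunE. Qed.
HB.instance Definition _ k :=
  GRing.isLinear.Build K F S _ (fox k) (fox_is_linear k).

Lemma fox_lie_gen k u l : F2d' u -> fox k [~ u, z l] = 'X_l * fox k u.
Proof.
move=> Du; rewrite /fox magnus_map_lie magnus_lieE magnus_map_gen /= ffunE.
by rewrite (magnus_map_derived Du) mul0r subr0.
Qed.

Lemma fox_br k a b :
  fox k [~ z a, z b] = 'X_b * (k == a)%:R - 'X_a * (k == b)%:R.
Proof. by rewrite /fox magnus_map_lie magnus_lieE !magnus_map_gen /= !ffunE. Qed.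

Lemma fox_br3 k a b c : fox k [~ z a, z b, z c] =
  'X_c * ('X_b * (k == a)%:R - 'X_a * (k == b)%:R).
Proof. by rewrite fox_lie_gen ?fox_br //; apply: derived_lie. Qed.

Lemma fox_ad_action k u f : F2d' u -> fox k (ad_action u f) = f * fox k u.
Proof.
move=> Du; elim/mpoly_lin_ind: f => [c f g IHf IHg|m].
  by rewrite !linearP /= IHf IHg mulrDl scalerAl.
elim/mnm_ind: m => [|m l IHm]; first by rewrite mpolyX0 ad_action1 mul1r.
rewrite mpolyXD ad_actionM // ad_actionU; last exact: derived_ad_action.
rewrite fox_lie_gen ?IHm; last exact: derived_ad_action.
by rewrite mulrCA mulrA.
Qed.

Variable D : {linear F -> F}.
Hypothesis D_delta : lie_delta D.

(** Both sides are derivations along the Magnus map agreeing on the generators;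
    delta maps the basis vector of y_i to that of x_i, whence the extra term.
    The first component has to be carried along for the bracket case. *)
Lemma fox_delta u :
  [/\ (magnus_map (D u)).1 = wd (magnus_map u).1,
      forall i, fox (rshift d i) (D u) = wd (fox (rshift d i) u)
    & forall i, fox (lshift d i) (D u)
        = wd (fox (lshift d i) u) + fox (rshift d i) u].
Proof.
have [DB DY DX] := D_delta.
elim/F2d_ind: u =>
  [|k|u v [u1 uy ux] [v1 vy vx]|c u [u1 uy ux]|u v [u1 uy ux] [v1 vy vx]].
- by split=> [|i|i]; rewrite !linear0 ?addr0.
- rewrite magnus_map_gen; case: (split_ordP k) => j ->.
    rewrite DX -/(X_ _) wdX /fox linear0 magnus_map_gen.
    by split=> // i; rewrite !ffunE wd_nat ?add0r ?eq_rlshift.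
  rewrite DY /fox magnus_map_gen magnus_map_gen -/(Y_ _) wdY.
  by split=> // i; rewrite !ffunE wd_nat ?eq_rlshift ?eq_rshift ?eq_lshift ?add0r.
- split=> [|i|i]; rewrite !linearD /=.
  + by rewrite u1 v1.
  + by rewrite uy vy.
  + by rewrite ux vx addrACA.
- split=> [|i|i]; rewrite !linearZ /=.
  + by rewrite u1.
  + by rewrite uy.
  + by rewrite ux scalerDr.
have fox_lie k a b : fox k [~ a, b]
    = (magnus_map b).1 * fox k a - (magnus_map a).1 * fox k b.
  by rewrite /fox magnus_map_lie magnus_lieE /= ffunE.
split=> [|i|i]; rewrite DB linearD /=.
- by rewrite !magnus_map_lie /= linear0 addr0.
- by rewrite !fox_lie u1 v1 uy vy linearB /= !wdM; ring.
- by rewrite !fox_lie u1 v1 ux vx linearB /= !wdM; ring.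
Qed.

End MagnusMap.

(** * Recovering an element from its Magnus coordinates *)

Section Reconstruction.
Variables (K : fieldType) (d : nat).
Hypothesis char0 : [pchar K] =i pred0.
Local Notation S := {mpoly K[d + d]}.
Local Notation F := (F2d K d).
Local Notation z := (gen K).
Implicit Types (u v w : F) (f g : S) (m : 'X_{1..d + d}) (k l : 'I_(d + d)).

(** The Fox derivative divided by the degree of each homogeneous component,
    as in the homotopy of Poincare's lemma. *)
Definition potential k u : S := bidiag (fun a b => (a + b).+1%:R^-1) (fox k u).

Fact potential_is_linear k : linear (potential k).
Proof. by move=> c u v; rewrite /potential !linearP. Qed.
HB.instance Definition _ k :=
  GRing.isLinear.Build K F S _ (potential k) (potential_is_linear k).

(** The Koszul - de Rham homotopy.  Seeing the Fox derivatives as the 1-form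
    sum_k (fox k u) dz_k, the formula applies the de Rham differential, divides
    by the degree, and reads dz_k dz_l as [z_k, z_l].  On [z_a, z_b] 'X_[m] the
    Jacobi identity collects the contributions of the derivatives of 'X_[m]
    into mdeg m copies of the element, and those of the variables z_a and z_b
    give one more each. *)
Lemma reconstruction u : F2d' u ->
  u = \sum_k \sum_l ad_action [~ z k, z l] (potential k u)^`M(l).
Proof.
move/derived_brspan; elim=> [|c v w _ IHv _ IHw|a b m].
- by rewrite big1 // => k _; rewrite big1 // => l _; rewrite !linear0.
- rewrite {1}IHv {1}IHw scaler_sumr -big_split; apply: eq_bigr => k _ /=.
  rewrite scaler_sumr -big_split; apply: eq_bigr => l _ /=.
  by rewrite !linearP.
pose c : K := (mdeg m).+2%:R.
have c0 : c != 0 by apply: natr_neq0.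
have potE k : potential k (ad_action [~ z a, z b] 'X_[m]) =
    c^-1 *: (('X_[m] * 'X_b) *+ (k == a) - ('X_[m] * 'X_a) *+ (k == b)).
  have mdegS e : (xdeg (m + U_(e))%MM + ydeg (m + U_(e))%MM).+1%:R = c.
    by rewrite -mdeg_xy mdegD mdeg1 addn1.
  rewrite /potential fox_ad_action ?fox_br; last exact: derived_lie.
  rewrite mulrBr !mulrA -!mpolyXD !mulr_natr linearB !linearMn /= !bidiagX.
  by rewrite !mdegS !mulNrn scalerBr !scalerMnr.
transitivity (c^-1 *: \sum_l (ad_action [~ z a, z l] ('X_[m] * 'X_b)^`M(l)
    - ad_action [~ z b, z l] ('X_[m] * 'X_a)^`M(l))); last first.
  rewrite exchange_big scaler_sumr; apply: eq_bigr => l _ /=.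
  rewrite (eq_bigr (fun k => c^-1 *:
    (ad_action [~ z k, z l] ('X_[m] * 'X_b)^`M(l) *+ (k == a)
     - ad_action [~ z k, z l] ('X_[m] * 'X_a)^`M(l) *+ (k == b)))) => [|k _].
    rewrite -scaler_sumr sumrB; congr (_ *: (_ - _)).
      by rewrite (bigD1 a) //= eqxx big1 ?addr0 // => k /negPf ->.
    by rewrite (bigD1 b) //= eqxx big1 ?addr0 // => k /negPf ->.
  by rewrite potE mderivZ mderivB !mderivMn linearZ linearB /= !raddfMn !mulNrn.
apply: (canRL (scalerK c0)); set t := ad_action _ _.
rewrite (eq_bigr (fun l => (t *+ (l == b) + t *+ (l == a)) + t *+ m l)) => [|l _].
  rewrite !big_split /= (bigD1 b) //= eqxx big1 ?addr0 => [|k /negPf ->//].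
  rewrite (bigD1 a) //= eqxx big1 ?addr0 => [|k /negPf ->//].
  by rewrite sumrMnr -mdegE -mulr2n -mulrnDr scaler_nat.
rewrite !mderivM !mderiv_var !linearD /=.
(* Differentiating the variable z_a or z_b. *)
have unit_part e k : ad_action [~ z e, z l] ('X_[m] * (k == l)%:R)
    = ad_action [~ z e, z k] 'X_[m] *+ (l == k).
  by rewrite mulr_natr linearMn eq_sym; case: eqP => [->|].
(* Differentiating 'X_[m]. *)
have euler_part : ad_action [~ z a, z l] ('X_[m]^`M(l) * 'X_b)
    - ad_action [~ z b, z l] ('X_[m]^`M(l) * 'X_a) = t *+ m l.
  rewrite ![_ * 'X__]mulrC !ad_actionM ?ad_actionU; try exact: derived_lie.
  have -> : t *+ m l = ad_action [~ z a, z b, z l] 'X_[m]^`M(l).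
    rewrite -ad_actionU -?ad_actionM; try exact: derived_lie.
    by rewrite euler_monomial scaler_nat linearMn.
  have J := lie_jacobi (z a) (z b) (z l).
  have -> : [~ z a, z b, z l] = [~ z a, z l, z b] - [~ z b, z l, z a].
    move: J; rewrite [ [~ z l, z a] ]lie_anti lieNl => /eqP.
    by rewrite subr_eq0 => /eqP <-; rewrite addrK.
  by rewrite ad_actionDl -scaleN1r ad_actionZl scaleN1r.
rewrite !unit_part ?opprD addrACA -[in RHS]euler_part addrC; congr (_ + _).
by rewrite (lie_anti (z a) (z b)) -scaleN1r ad_actionZl scaleN1r mulNrn opprK.
Qed.

Lemma foxD k u v : fox k (u + v) = fox k u + fox k v.
Proof. exact: linearD. Qed.

Lemma foxB k u v : fox k (u - v) = fox k u - fox k v.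
Proof. exact: linearB. Qed.

(** The Magnus representation is faithful on the derived algebra, so that
    identities there become identities between polynomials. *)
Lemma fox_inj u v :
  F2d' u -> F2d' v -> (forall k, fox k u = fox k v) -> u = v.
Proof.
move=> Du Dv uv; rewrite (reconstruction Du) (reconstruction Dv).
apply: eq_bigr => k _; apply: eq_bigr => l _.
by rewrite /potential uv.
Qed.

End Reconstruction.

(** * Constants of the derived algebra *)

Section Generation.
Variables (K : fieldType) (d : nat).
Hypothesis char0 : [pchar K] =i pred0.
Local Notation S := {mpoly K[d + d]}.
Local Notation F := (F2d K d).
Local Notation x_ i := (gx K i).
Local Notation y_ i := (gy K i).
Implicit Types (u v w : F) (f g : S) (i j p q : 'I_d) (k : 'I_(d + d)).

Variable deltaP : {linear S -> S}.
Hypothesis deltaP_spec : poly_delta deltaP.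
Local Notation G := (generated (fun f => deltaP f = 0) (@generators K d)).

Lemma generated_act u f : G u -> wd f = 0 -> G (ad_action u f).
Proof.
by move=> Gu wf; apply: gen_act => //; rewrite (poly_deltaE deltaP_spec).
Qed.

Lemma generatedZ c u : G u -> G (c *: u).
Proof.
rewrite -[X in _ *: X]ad_action1 -linearZ /= => Gu; apply: generated_act => //.
by rewrite linearZ /= (wd_nat K d 1) scaler0.
Qed.

Lemma generatedN u : G u -> G (- u).
Proof. by rewrite -scaleN1r; apply: generatedZ. Qed.

Lemma generatedB u v : G u -> G v -> G (u - v).
Proof. by move=> Gu Gv; apply/gen_D/generatedN. Qed.

Lemma generated_sum (I : Type) (r : seq I) (P : pred I) (H : I -> F) :
  (forall l, P l -> G (H l)) -> G (\sum_(l <- r | P l) H l).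
Proof. by move=> GH; elim/big_ind: _ => //; [apply: gen_0 | apply: gen_D]. Qed.

Ltac derived := by repeat first
  [ apply: derived_lie | apply: derived_ad_action | apply: derived_B
  | apply: derived_Z | apply: derived_D ].

Definition sym i j : F := [~ x_ i, y_ j] + [~ x_ j, y_ i].

Lemma generated_sym i j : G (sym i j).
Proof.
rewrite /sym; case: (ltngtP i j) => [ij|ji|/val_inj ->].
- exact/gen_S/gen_xy_sym.
- by rewrite addrC; apply/gen_S/gen_xy_sym.
- by apply: gen_D; apply/gen_S/gen_xy.
Qed.

Lemma generated_xx i j : G [~ x_ i, x_ j].
Proof.
case: (ltngtP i j) => [ij|ji|/val_inj ->].
- exact/gen_S/gen_xx.
- by rewrite lie_anti; apply/generatedN/gen_S/gen_xx.
- by rewrite liexx; apply: gen_0.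
Qed.

(** Along the chain [y_i, y_j], [x_i, y_j] + [y_i, x_j], 2 [x_i, x_j] of delta,
    a constant with polynomial coefficients is determined by its coefficient f
    at [x_i, x_j], which satisfies wd^3 f = 0.  This is twice that constant. *)
Definition triplet i j f : F :=
  ad_action [~ x_ i, x_ j] (f *+ 2)
  - ad_action ([~ x_ i, y_ j] + [~ y_ i, x_ j]) (wd f)
  + ad_action [~ y_ i, y_ j] (wd (wd f)).

Lemma tripletD i j f g : triplet i j (f + g) = triplet i j f + triplet i j g.
Proof.
rewrite /triplet mulrnDl !linearD /= ?opprD.
by rewrite [LHS](AC (2*2*2) (1*3*5*(2*4*6))).
Qed.

(** Constants of wd pass through triplet, so by ker_iter_wd only f = 1, Y_q and
    Y_j Y_q remain to be treated. *)
Lemma triplet_mul i j f g :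
  wd g = 0 -> triplet i j (g * f) = ad_action (triplet i j f) g.
Proof.
move=> wg; have wdg h : wd (h * g) = wd h * g by rewrite wdM wg mulr0 addr0.
rewrite mulrC /triplet !wdg -mulrnAl -!scaleN1r !(ad_actionDl, ad_actionZl).
by rewrite !ad_actionM ?ad_actionDl //; derived.
Qed.

Lemma fox_sym k i j : fox k (sym i j) =
  (Y_ j * (k == lshift d i)%:R - X_ i * (k == rshift d j)%:R)
  + (Y_ i * (k == lshift d j)%:R - X_ j * (k == rshift d i)%:R).
Proof. by rewrite /sym linearD /= !fox_br. Qed.

Lemma fox_triplet k i j f : fox k (triplet i j f) =
  f *+ 2 * (X_ j * (k == lshift d i)%:R - X_ i * (k == lshift d j)%:R)
  - wd f * (Y_ j * (k == lshift d i)%:R - X_ i * (k == rshift d j)%:R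
            + (X_ j * (k == rshift d i)%:R - Y_ i * (k == lshift d j)%:R))
  + wd (wd f) * (Y_ j * (k == rshift d i)%:R - Y_ i * (k == rshift d j)%:R).
Proof.
have ? := @derived_lie K d; have ? := @derived_D K d.
by rewrite /triplet linearD linearB /= !fox_ad_action ?linearD /= ?fox_br; auto.
Qed.

Lemma triplet_anti i j f : triplet j i f = - triplet i j f.
Proof.
apply: (fox_inj char0) => [||k]; rewrite -?scaleN1r; try derived.
by rewrite linearZ /= scaleN1r !fox_triplet; ring.
Qed.

Lemma triplet_deg3 i p q (w := [~ x_ i, x_ p, y_ q] - [~ x_ i, y_ p, x_ q]) :
  triplet i p (Y_ q) = w + w + ad_action (sym i p) (X_ q).
Proof.
apply: (fox_inj char0) => [||k]; try derived.
rewrite fox_triplet 2!foxD fox_ad_action; try derived.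
by rewrite fox_sym /w foxB !fox_br3 wdY wdX /X_ /Y_; ring.
Qed.

Lemma triplet_repeated i p :
  triplet i p (Y_ i) = ad_action (sym i i) (X_ p) - ad_action (sym i p) (X_ i).
Proof.
apply: (fox_inj char0) => [||k]; try derived.
rewrite fox_triplet foxB !fox_ad_action; try derived.
by rewrite !fox_sym wdY wdX; ring.
Qed.

(** In the alternating sum of triplet over i, j, k the brackets [x, x]
    contribute 2 w, and by the Jacobi identity the mixed brackets contribute another w. *)
Lemma triplet_alt i j (k : 'I_d)
    (w := [~ x_ i, x_ j, y_ k] - [~ x_ i, x_ k, y_ j] + [~ x_ j, x_ k, y_ i]) :
  triplet j k (Y_ i) = w + w + w - triplet i j (Y_ k) + triplet i k (Y_ j).
Proof.
apply: (fox_inj char0) => [||l]; try derived.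
rewrite fox_triplet foxD foxB 2!foxD !fox_triplet /w foxD foxB.
by rewrite !fox_br3 !wdY !wdX /X_ /Y_; ring.
Qed.

(** By antisymmetry in i and p it is enough to treat p < q, q = i, q < i < p,
    and i = p, where the element vanishes. *)
Lemma generated_tripletY i p q : G (triplet i p (Y_ q)).
Proof.
have lt_case i' p' q' : (p' < q')%N -> G (triplet i' p' (Y_ q')).
  move=> pq; rewrite triplet_deg3; apply: gen_D.
    by apply: gen_D; apply/gen_S/gen_deg3.
  by apply/generated_act; [apply: generated_sym | apply: wdX].
have rep_case i' p' : G (triplet i' p' (Y_ i')).
  by rewrite triplet_repeated; apply: generatedB; apply: generated_act;
    rewrite ?wdX //; apply: generated_sym.
have alt_case i' p' q' :
    (q' < i')%N -> (i' < p')%N -> G (triplet i' p' (Y_ q')).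
  move=> qi ip; rewrite (triplet_alt q'); apply: gen_D.
    apply: generatedB; last exact: lt_case.
    by apply: gen_D; [apply: gen_D|]; apply/gen_S/gen_deg3_alt.
  by rewrite triplet_anti; apply/generatedN/lt_case.
case: (ltngtP p q) => [pq|qp|/val_inj <-]; first exact: lt_case.
  case: (ltngtP i q) => [iq|qi|/val_inj <-]; last exact: rep_case.
    by rewrite triplet_anti; apply/generatedN/lt_case.
  case: (ltngtP i p) => [ip|pi|/val_inj <-]; first exact: alt_case.
    by rewrite triplet_anti; apply/generatedN/alt_case.
  suff -> : triplet i i (Y_ q) = 0 by apply: gen_0.
  apply: (fox_inj char0) => [||k]; [derived | exact: derived_0 |].
  by rewrite linear0 fox_triplet; ring.
by rewrite triplet_anti; apply/generatedN/rep_case.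
Qed.

(** In Magnus coordinates, with basis vectors e, put
    a_ij = Y_j e_(x_i) - X_j e_(y_i), so that sym i j becomes a_ij + a_ji.
    Modulo sym i p times a minor, half of the left-hand side is
    a_ij minor p q - a_pq minor i j.  The Pluecker relations give
    a_ij minor p q + a_ip minor q j + a_iq minor j p = 0 and the three similar
    relations with first index j, p, q; their signed sum expresses
    (a_ij - a_ji) minor p q - (a_pq - a_qp) minor i j by symmetric brackets. *)
Lemma triplet_deg4 i p j q : triplet i p (Y_ j * Y_ q) =
  ad_action (sym i j) (minor p q) - ad_action (sym p q) (minor i j)
  - ad_action (sym i q) (minor j p) + ad_action (sym j p) (minor q i)
  + ad_action (sym j q) (minor i p).
Proof.
apply: (fox_inj char0) => [||k]; try derived.
rewrite fox_triplet 2!foxD 2!foxB !fox_ad_action; try derived.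
by rewrite !fox_sym !wdM linearD /= !wdM !wdY !wdX /minor; ring.
Qed.

Lemma generated_tripletYY i p j q : G (triplet i p (Y_ j * Y_ q)).
Proof.
have Gs i' j' p' q' : G (ad_action (sym i' j') (minor p' q')).
  by apply: generated_act; [apply: generated_sym | apply: wd_minor].
rewrite triplet_deg4; apply: gen_D => //; apply: gen_D => //.
by do 2?[apply: generatedB].
Qed.

Lemma triplet_sum i j (I : finType) (f : I -> S) :
  triplet i j (\sum_l f l) = \sum_l triplet i j (f l).
Proof.
apply: (big_morph (triplet i j)) => [f1 f2|]; first exact: tripletD.
by rewrite /triplet mul0rn !linear0 ?subr0 !addr0.
Qed.

Lemma generated_triplet i p f : wd (wd (wd f)) = 0 -> G (triplet i p f).
Proof.
move=> wf; have [g0 [g [wg0 wg ->]]] : yspan 2 f by apply: ker_iter_wd.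
rewrite tripletD triplet_sum; apply: gen_D; last first.
  apply: generated_sum => j _; have [h0 [h [wh0 wh ->]]] := wg j.
  rewrite mulrDr tripletD mulr_sumr triplet_sum; apply: gen_D.
    rewrite mulrC triplet_mul //; apply: generated_act => //.
    exact: generated_tripletY.
  apply: generated_sum => q _; rewrite mulrA mulrC triplet_mul //.
  by apply: generated_act => //; apply: generated_tripletYY.
rewrite -[g0]mulr1 triplet_mul //; apply: generated_act => //.
rewrite /triplet (wd_nat K d 1) !linear0 ?subr0 !addr0.
rewrite mulr2n linearD /= ad_action1.
by apply: gen_D; apply: generated_xx.
Qed.

Variable D : {linear F -> F}.
Hypothesis D_delta : lie_delta D.

Lemma wd_potential u k :
  wd (potential k u) = bidiag (fun a b => (a + b).+1%:R^-1) (wd (fox k u)).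
Proof. by apply: wd_bidiag => a b; rewrite addSnnS. Qed.

(** Equivariance of the Fox derivatives makes the antisymmetrised coefficients
    A, B, C of the reconstruction formula satisfy wd A_ij = B_ji - B_ij,
    wd B_ij = - C_ij and wd C_ij = 0.  The symmetric part of B is therefore
    constant, and its antisymmetric part and C are the successive derivatives
    of A prescribed by triplet. *)
Lemma constant_generated u : F2d' u -> D u = 0 -> G u.
Proof.
move=> Du Du0.
pose vx i := potential (lshift d i) u; pose vy i := potential (rshift d i) u.
have wvy i : wd (vy i) = 0.
  have [_ fy _] := fox_delta D_delta u.
  by rewrite wd_potential -fy Du0 !linear0.
have wvx i : wd (vx i) = - vy i.
  have [_ _ fx] := fox_delta D_delta u.
  rewrite wd_potential /vy /potential -linearN; congr (bidiag _ _).
  by apply/eqP; rewrite -addr_eq0 -fx Du0 linear0.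
pose A i j := dX j (vx i) - dX i (vx j).
pose B i j := dY j (vx i) - dX i (vy j).
pose C i j := dY j (vy i) - dY i (vy j).
have wd_dX i f : wd (dX i f) = dX i (wd f) - dY i f.
  by rewrite dX_wd addrC addKr.
have wA i j : wd (A i j) = B j i - B i j.
  by rewrite linearB /= !wd_dX !wvx !linearN /= /B; ring.
have wB i j : wd (B i j) = - C i j.
  by rewrite linearB /= wd_dX -dY_wd wvx wvy linearN linear0 /= /C; ring.
have wC i j : wd (C i j) = 0.
  by rewrite linearB /= -!dY_wd !wvy /dY !mderiv0 subrr.
(* The t i j add up to 4 u: a factor 2 is built into triplet, another one comes
   from symmetrising over the ordered pairs (i, j). *)
pose t i j := triplet i j (A i j) + ad_action (sym i j) (B i j + B j i).
suff -> : u = 4%:R^-1 *: \sum_i \sum_j t i j.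
  apply/generatedZ/generated_sum => i _; apply: generated_sum => j _.
  apply: gen_D.
    apply: generated_triplet; rewrite wA.
    move: (wB i j) (wB j i) (wC i j) (wC j i).
    move: (B i j) (B j i) (C i j) (C j i) => b b' c c' wb wb' wc wc'.
    by rewrite !linearB /= wb wb' !linearN /= wc wc'; ring.
  apply: generated_act; first exact: generated_sym.
  by rewrite [wd (_ + _)]linearD /= !wB /C; ring.
have four0 : (4%:R : K) != 0 by apply: natr_neq0.
apply: (canRL (scalerK four0)).
pose r i j := ad_action [~ x_ i, x_ j] (dX j (vx i))
  + ad_action [~ x_ i, y_ j] (dY j (vx i))
  + ad_action [~ y_ i, x_ j] (dX j (vy i))
  + ad_action [~ y_ i, y_ j] (dY j (vy i)).
have tr i j : t i j = (r i j + r j i) *+ 2.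
  rewrite mulr2n /t /r; apply: (fox_inj char0) => [||k]; try derived.
  rewrite [LHS]foxD fox_triplet fox_ad_action; try derived.
  rewrite fox_sym !foxD !fox_ad_action ?fox_br; try exact: derived_lie.
  rewrite wA [wd (_ - _)]linearB /= !wB /A /B /C /X_ /Y_; ring.
have ur : u = \sum_i \sum_j r i j.
  rewrite {1}(reconstruction char0 Du) big_split_ord /= -big_split /=.
  apply: eq_bigr => i _; rewrite !big_split_ord /= -!big_split /=.
  by apply: eq_bigr => j _; rewrite /r !addrA.
under eq_bigr do under eq_bigr do rewrite tr.
under eq_bigr do rewrite sumrMnl big_split.
rewrite sumrMnl big_split /= [X in _ + X]exchange_big /= -ur.
by rewrite -mulr2n -mulrnA scaler_nat.
Qed.

Lemma generators_constant u : generators u -> F2d' u /\ D u = 0.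
Proof.
have [DB DY DX] := D_delta.
case=> [i|i j _|i j _|i p q _|i j k _ _|i j p q _ _].
all: split; first derived.
all: rewrite ?(linearD, linearN) /= ?linearN /= !DB ?lieDl !(DX, DY).
all: rewrite !(lie0l, lie0r) ?(addr0, add0r).
- by rewrite liexx.
- by [].
- by rewrite (lie_anti (x_ i)) subrr.
- by rewrite subrr.
- rewrite addrAC -(lie_jacobi (x_ i) (x_ j) (x_ k)); congr (_ + _).
  by rewrite (lie_anti (x_ i) (x_ k)) lieNl.
- rewrite [X in X - _ - _](AC (2*2) ((1*4)*(2*3))) /=.
  by rewrite addrK subrr.
Qed.

Lemma generated_constant u : G u -> F2d' u /\ D u = 0.
Proof.
elim=> [v|| v w _ [Dv v0] _ [Dw w0]|v f _ [Dv v0] wf] {u}.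
- exact: generators_constant.
- by split; [apply: derived_0 | rewrite linear0].
- by split; [apply: derived_D | rewrite linearD /= v0 w0 addr0].
split; first exact: derived_ad_action.
rewrite (delta_ad_action D_delta) // v0 ad_action0l add0r.
by rewrite -(poly_deltaE deltaP_spec) wf linear0.
Qed.

End Generation.

Theorem corollary3p4 (K : fieldType) (d : nat)
    (char0 : [pchar K] =i pred0) (d_ge2 : (2 <= d)%N)
    (deltaP : {linear {mpoly K[d + d]} -> {mpoly K[d + d]}})
    (deltaP_spec : poly_delta deltaP)
    (deltaF : {linear F2d K d -> F2d K d})
    (deltaF_spec : lie_delta deltaF) :
  forall u : F2d K d,
    (F2d' u /\ deltaF u = 0) <->
    generated (fun f => deltaP f = 0) (@generators K d) u.
Proof.
move=> u; split=> [[Du Du0]|].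
  exact: (constant_generated char0 deltaP_spec deltaF_spec).
exact: (generated_constant deltaP_spec deltaF_spec).
Qed.
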